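(* Let $p\ge1$, $n\ge2$, $m\ge0$ be integers and let $\zeta,\eta\in\widehat{S}_p$. Then $$Z_m^p(\zeta,\eta)=\sum_{k=0}^{p-1}|\zeta|^{2k}|\overline{\eta}|^{2k}Z_{m-2k}(\zeta,\eta).$$
   Context: $S$ is the unit sphere in $\mathbb{R}^n\subset\mathbb{C}^n$ centred at the origin, $\sigma$ its normalised surface measure, $\widehat{S}_p:=\bigcup_{k=0}^{p-1}e^{\frac{k\pi i}{p}}S\subset\mathbb{C}^n$. For $z\in\mathbb{C}^n$, $|z|=(\sum_jz_j^2)^{1/2}$ (principal square root), so $|z|^{2k}=(\sum_jz_j^2)^k$ is a complex number; $\overline{\eta}$ is the componentwise conjugate. $\mathcal{H}_m^p(\mathbb{C}^n)$ is the space of complex polynomials $u$ on $\mathbb{C}^n$, homogeneous of degree $m$, with $\Delta^pu=0$, $\Delta=\sum_j\partial^2/\partial x_j^2$; $\mathcal{H}_m^p(\widehat{S}_p)$ is the space of their restrictions to $\widehat{S}_p$, with inner product $\langle f,g\rangle_{\widehat{S}_p}:=\frac1p\int_S\sum_{j=0}^{p-1}f(e^{\frac{j\pi i}{p}}\xi)\overline{g(e^{\frac{j\pi i}{p}}\xi)}\,d\sigma(\xi)$. For $\eta\in\widehat{S}_p$ the zonal polyharmonic $Z_m^p(\cdot,\eta)$ of degree $m$ and order $p$ with pole $\eta$ is the unique element of $\mathcal{H}_m^p(\widehat{S}_p)$ with $q(\eta)=\langle q,Z_m^p(\cdot,\eta)\rangle_{\widehat{S}_p}$ for all $q\in\mathcal{H}_m^p(\widehat{S}_p)$.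 Zonal harmonics are the case $p=1$: for $\eta\in S$, $Z_m(\cdot,\eta):=Z_m^1(\cdot,\eta)$ on $S$. They are extended to $\widehat{S}_p\times\widehat{S}_p$ by $Z_m(e^{\varphi i}\zeta,e^{\psi i}\eta):=e^{m(\varphi-\psi)i}Z_m(\zeta,\eta)$ for $\zeta,\eta\in S$, $\varphi,\psi\in\mathbb{R}$. By convention $Z_l\equiv0$ for $l<0$. *)

(* Defs.v *)
From HB Require Import structures.
From mathcomp Require Import all_boot all_order all_algebra.
From mathcomp Require Import complex.
(* The notations of mpoly clash with those of MathComp-Analysis. *)
From mathcomp Require Import -(notations) mpoly.
From mathcomp Require Import all_classical all_reals all_analysis.
From mathcomp Require Import measurable_realfun.

Set Implicit Arguments.
Unset Strict Implicit.
Unset Printing Implicit Defensive.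

Import Order.TTheory GRing.Theory Num.Theory.
Import numFieldNormedType.Exports.

Local Open Scope classical_set_scope.
Local Open Scope ring_scope.
Local Open Scope complex_scope.

(* Lebesgue measure on R^n, as an iterated product measure. *)
Section lebesgue_measure_on_tuples.
Context (R : realType).

Definition tuple_cons n (x : R * n.-tuple R) : n.+1.-tuple R :=
  [the n.+1.-tuple R of x.1 :: x.2].

Lemma measurable_tuple_cons n : measurable_fun setT (@tuple_cons n).
Proof. exact: (measurable_cons measurable_fst measurable_snd). Qed.

Section step.
Context n (mu : {sigma_finite_measure set (n.-tuple R) -> \bar R}).

Definition lebesgue_cons : set (n.+1.-tuple R) -> \bar R :=
  pushforward (@lebesgue_measure R \x mu)%E (@tuple_cons n).

Let lebesgue_cons0 : lebesgue_cons set0 = 0%E.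
Proof. by rewrite /lebesgue_cons /pushforward preimage_set0 measure0. Qed.

Let lebesgue_cons_ge0 A : (0 <= lebesgue_cons A)%E.
Proof.
rewrite /lebesgue_cons /pushforward; move: (_ @^-1` _) => ?; exact: measure_ge0.
Qed.

Let lebesgue_cons_sigma_additive : semi_sigma_additive lebesgue_cons.
Proof.
move=> F mF tF mUF; rewrite /lebesgue_cons /pushforward preimage_bigcup.
have mcons := @measurable_tuple_cons n.
apply: measure_semi_sigma_additive.
- by move=> k; rewrite -[X in measurable X]setTI; apply: mcons.
- apply/trivIsetP => /= i j _ _ ij; rewrite -preimage_setI.
  by move/trivIsetP : tF => /(_ _ _ _ _ ij) ->//; rewrite preimage_set0.
- by rewrite -preimage_bigcup -[X in measurable X]setTI; apply: mcons.
Qed.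

HB.instance Definition _ := isMeasure.Build _ _ _ lebesgue_cons
  lebesgue_cons0 lebesgue_cons_ge0 lebesgue_cons_sigma_additive.

Lemma lebesgue_consX (A : set R) (B : set (n.-tuple R)) :
  measurable A -> measurable B ->
  lebesgue_cons [set x | A (thead x) /\ B [tuple of behead x]] =
  (lebesgue_measure A * mu B)%E.
Proof.
move=> mA mB; rewrite -product_measure1E// /lebesgue_cons /pushforward.
congr ((_ \x _)%E _); apply/funext => -[x t]/=.
have -> : [tuple of behead (tuple_cons (x, t))] = t by exact/val_inj.
by [].
Qed.

Let lebesgue_cons_sigma_finite : sigma_finite setT lebesgue_cons.
Proof.
have /sigma_finiteP[F [TF ndF Foo]] := sigma_finiteT (@lebesgue_measure R).
have /sigma_finiteP[G [TG ndG Goo]] := sigma_finiteT mu.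
exists (fun k => [set x | F k (thead x) /\ G k [tuple of behead x]]).
  apply/esym; rewrite -subTset => x _.
  have [k _ Fk] : (\bigcup_k F k) (thead x) by rewrite -TF.
  have [l _ Gl] : (\bigcup_k G k) [tuple of behead x] by rewrite -TG.
  exists (maxn k l) => //; split.
  - by move: Fk; exact/subsetPset/ndF/leq_maxl.
  - by move: Gl; exact/subsetPset/ndG/leq_maxr.
move=> k; have [mF Fk] := Foo k; have [mG Gk] := Goo k; split.
  apply: measurableI.
  - rewrite -[X in measurable X]setTI; exact: measurable_tnth.
  - rewrite -[X in measurable X]setTI; exact: measurable_behead.
by rewrite lebesgue_consX// lte_mul_pinfty// ge0_fin_numE.
Qed.

HB.instance Definition _ := Measure_isSigmaFinite.Build _ _ _ lebesgue_cons
  lebesgue_cons_sigma_finite.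

End step.

Fixpoint lebesgue_tuple n : {sigma_finite_measure set (n.-tuple R) -> \bar R} :=
  if n is k.+1 then lebesgue_cons (lebesgue_tuple k) else \d_ [tuple].

End lebesgue_measure_on_tuples.

Section sphere_measure.
Context (R : realType) (n : nat).
Implicit Types (x : n.-tuple R) (E : set (n.-tuple R)).

Definition sphere : set (n.-tuple R) := [set x | \sum_(i < n) tnth x i ^+ 2 = 1].

(* With sigma (E) := lambda (cone E) / lambda (unit ball), the surface measure of
   the unit sphere is recovered from Lebesgue measure as in polar coordinates:
   (surface area of E) = n * lambda (cone E), and the factor n cancels in the
   normalisation. *)
Definition cone E : set (n.-tuple R) :=
  [set [tuple r * tnth s i | i < n] | r in `]0, 1] & s in E `&` sphere].

Definition cone_measure E : \bar R := lebesgue_tuple R n (cone E).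

Definition enorm x := Num.sqrt (\sum_(i < n) tnth x i ^+ 2).

Definition radial x := [tuple (enorm x)^-1 * tnth x i | i < n].

Lemma enormM r x : 0 <= r -> enorm [tuple r * tnth x i | i < n] = r * enorm x.
Proof.
move=> r0; rewrite /enorm.
under eq_bigr do rewrite tnth_mktuple exprMn.
by rewrite -mulr_sumr sqrtrM ?sqr_ge0// sqrtr_sqr ger0_norm.
Qed.

Lemma sphere_enormP x : sphere x <-> enorm x = 1.
Proof.
rewrite /sphere/= /enorm; split => [->|]; first by rewrite sqrtr1.
move=> h; rewrite -[LHS]sqr_sqrtr ?h ?expr1n//.
by apply: sumr_ge0 => i _; exact: sqr_ge0.
Qed.

Lemma coneE E : cone E = enorm @^-1` `]0, 1] `&` radial @^-1` E.
Proof.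
apply/seteqP; split => [_ [r /= r01 [s [Es /sphere_enormP s1] <-]]|x [/= x01 Ex]].
  have /andP[r0 r1] : (0 < r <= 1) by move: r01; rewrite in_itv.
  rewrite /preimage/= /radial enormM ?ltW// s1 mulr1; split => //.
  rewrite [X in E X](_ : _ = s)//; apply: eq_from_tnth => i.
  by rewrite !tnth_mktuple mulKf// gt_eqF.
have /andP[r0 r1] : (0 < enorm x <= 1) by move: x01; rewrite /= in_itv.
exists (enorm x) => //; exists (radial x).
  split => //; apply/sphere_enormP; rewrite enormM ?invr_ge0 ?ltW//.
  by rewrite mulVf// gt_eqF.
by apply: eq_from_tnth => i; rewrite !tnth_mktuple mulVKf// gt_eqF.
Qed.

Lemma measurable_enorm : measurable_fun setT enorm.
Proof.
rewrite (_ : enorm = (@powR R ^~ 2^-1) \o (fun x => \sum_(i < n) tnth x i ^+ 2)).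
  apply: (measurableT_comp (@measurable_powR R _)).
  by apply: measurable_sum => i; apply: measurable_funX; exact: measurable_tnth.
apply/funext => x; rewrite /= powR12_sqrt//.
by apply: sumr_ge0 => i _; exact: sqr_ge0.
Qed.

Lemma measurable_radial : measurable_fun setT radial.
Proof.
apply/measurable_fun_tnthP => i.
rewrite (_ : _ \o _ = fun x => (enorm x)^-1 * tnth x i); last first.
  by apply/funext => x; rewrite /= tnth_mktuple.
apply: measurable_funM; last exact: measurable_tnth.
rewrite (_ : (fun x => _) = (@powR R ^~ (-1)) \o enorm); last first.
  by apply/funext => x; rewrite /= powR_inv1// sqrtr_ge0.
exact: (measurableT_comp (@measurable_powR R _) measurable_enorm).
Qed.

Lemma cone_measure0 : cone_measure set0 = 0%E.
Proof. by rewrite /cone_measure coneE preimage_set0 setI0 measure0. Qed.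

Lemma cone_measure_ge0 E : (0 <= cone_measure E)%E.
Proof. by rewrite /cone_measure; move: (cone E) => A; exact: measure_ge0. Qed.

Lemma measurable_cone E : measurable E -> measurable (cone E).
Proof.
move=> mE; rewrite coneE; apply: measurableI; rewrite -[X in measurable X]setTI.
  by apply: measurable_enorm.
by apply: measurable_radial.
Qed.

Lemma cone_measure_sigma_additive : semi_sigma_additive cone_measure.
Proof.
move=> F mF tF mUF; rewrite /cone_measure.
have cU : cone (\bigcup_k F k) = \bigcup_k cone (F k).
  rewrite coneE preimage_bigcup setI_bigcupr.
  by apply: eq_bigcupr => k _; rewrite coneE.
rewrite cU; apply: measure_semi_sigma_additive.
- by move=> k; exact: measurable_cone.
- apply/trivIsetP => /= i j _ _ ij; rewrite !coneE setIACA setIid -preimage_setI.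
  by move/trivIsetP : tF => /(_ _ _ _ _ ij) ->//; rewrite preimage_set0 setI0.
- by rewrite -cU; exact: measurable_cone.
Qed.

HB.instance Definition _ := isMeasure.Build _ _ _ cone_measure
  cone_measure0 cone_measure_ge0 cone_measure_sigma_additive.

Definition sphere_measure : set (n.-tuple R) -> \bar R :=
  mnormalize cone_measure point.

HB.instance Definition _ := Probability.on sphere_measure.

End sphere_measure.

(* In dimension at least 1, [sphere_measure] is not the default of [mnormalize]. *)
Section sphere_measureE.
Context (R : realType).

Lemma measurable_box n (A : set R) : measurable A ->
  measurable [set x : n.-tuple R | forall i, A (tnth x i)].
Proof.
move=> mA.
rewrite (_ : mkset _ = \bigcap_(i in [set: 'I_n]) ((@tnth n R)^~ i @^-1` A)).
  apply: fin_bigcap_measurable => // i _.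
  by rewrite -[X in measurable X]setTI; apply: measurable_tnth.
by apply/seteqP; split => [x h i _|x h i]; exact: h.
Qed.

Lemma lebesgue_tuple_box n (A : set R) : measurable A ->
  lebesgue_tuple R n [set x | forall i, A (tnth x i)] = (lebesgue_measure A ^+ n)%E.
Proof.
move=> mA; elim: n => [|n IHn].
  by rewrite /= diracE mem_set// => -[].
rewrite expeS -IHn -lebesgue_consX//; last exact: measurable_box.
congr (lebesgue_cons _ _); apply/seteqP; split => [x /= h|x /= [h0 h] i].
  split; first by rewrite /thead; exact: h.
  by move=> i; move: (h (lift ord0 i)); rewrite [in X in X -> _](tuple_eta x) tnthS.
rewrite (tuple_eta x); case: (unliftP ord0 i) => [j ->|->].
  by rewrite tnthS.
by rewrite tnth0.
Qed.

Lemma cone_measureT_fin n : (@cone_measure R n setT < +oo)%E.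
Proof.
set B := [set x : n.-tuple R | forall i, `[-1, 1]%classic (tnth x i)].
have : (lebesgue_tuple R n B < +oo)%E.
  by rewrite lebesgue_tuple_box// lebesgue_measure_itv/= lte_fin gtrN// -EFin_expe ltry.
apply: le_lt_trans; apply: le_measure; rewrite ?inE//.
- exact: measurable_cone.
- exact: measurable_box.
move=> _ [r /= r01 [s [_ s1] <-]] i /=.
move: r01; rewrite tnth_mktuple !in_itv/= -ler_norml => /andP[r0 r1].
rewrite normrM mulr_ile1//; first by rewrite gtr0_norm.
rewrite -(@ler_pXn2r _ 2)// ?nnegrE// expr1n real_normK ?num_real// -s1.
rewrite (bigD1 i)//= lerDl; apply: sumr_ge0 => j _; exact: sqr_ge0.
Qed.

Lemma cone_measureT_gt0 n : (0 < @cone_measure R n.+1 setT)%E.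
Proof.
set B := [set x : n.+1.-tuple R | forall i, `]0, n.+1%:R^-1]%classic (tnth x i)].
have : (0 < lebesgue_tuple R n.+1 B)%E.
  rewrite lebesgue_tuple_box// lebesgue_measure_itv lte_fin invr_gt0 ltr0Sn.
  by rewrite -EFinD -EFin_expe lte_fin subr0 exprn_gt0// invr_gt0 ltr0Sn.
move=> B0; apply: (lt_le_trans B0); apply: le_measure; rewrite ?inE//.
- exact: measurable_box.
- exact: measurable_cone.
move=> x Bx; rewrite coneE; split => //=.
have x0 i : 0 < tnth x i <= n.+1%:R^-1 by have := Bx i; rewrite /= in_itv.
rewrite in_itv/=; apply/andP; split.
  rewrite sqrtr_gt0 big_ord_recl ltr_pwDl//.
    by rewrite exprn_gt0//; case/andP: (x0 ord0).
  by apply: sumr_ge0 => i _; exact: sqr_ge0.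
rewrite -sqrtr1 ler_sqrt//.
apply: (@le_trans _ _ (\sum_(i < n.+1) n.+1%:R^-1)).
  apply: ler_sum => i _; have /andP[xi0 xi1] := x0 i.
  rewrite expr2 -[leRHS]mulr1 ler_pM//; [exact: ltW|exact: ltW|].
  by rewrite (le_trans xi1)// invf_le1// ler1n.
by rewrite sumr_const card_ord -[_ *+ _]mulr_natr mulVf// pnatr_eq0.
Qed.

Lemma sphere_measureE n (E : set (n.+1.-tuple R)) :
  sphere_measure E =
  (cone_measure E * (fine (@cone_measure R n.+1 setT))^-1%:E)%E.
Proof.
rewrite /sphere_measure /mnormalize/= gt_eqF ?cone_measureT_gt0//=.
by rewrite lt_eqF// cone_measureT_fin.
Qed.

End sphere_measureE.

Section polyharmonics.
Context (R : realType) (n : nat).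
Local Notation C := R[i].
Local Notation Cn := 'rV[C]_n.

Definition expi (t : R) : C := cos t +i* sin t.

Definition toCn (x : n.-tuple R) : Cn := \row_i (tnth x i)%:C.

(* |z| = (sum_j z_j^2)^(1/2), a complex number; [sqrtc] is the principal root
   (nonnegative real part), unlike [sqrtC]. *)
Definition cnorm (z : Cn) : C := sqrtc (\sum_(j < n) z 0 j ^+ 2).

Definition twist p k : C := expi (k%:R * pi / p%:R).

Definition hatS p : set Cn :=
  \bigcup_(k in `I_p) [set twist p k *: toCn x | x in @sphere R n].

Definition laplacian (u : mpoly n C) : mpoly n C :=
  \sum_(j < n) mderiv j (mderiv j u).

Definition Hpoly p m : set (mpoly n C) :=
  [set u | u \is ishomog1 m mdeg /\ iter p laplacian u = 0].

(* A function on [hatS p] is represented by its extension by 0 to C^n. *)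
Definition Hhat p m : set (Cn -> C) :=
  [set patch (fun=> 0) (hatS p) (fun z => meval (z 0) u) | u in Hpoly p m].

Definition sphere_integral (f : n.-tuple R -> C) : C :=
  (\int[@sphere_measure R n]_(x in @sphere R n) complex.Re (f x)) +i*
  (\int[@sphere_measure R n]_(x in @sphere R n) complex.Im (f x)).

Definition inner p (f g : Cn -> C) : C :=
  p%:R^-1 * sphere_integral (fun x =>
    \sum_(j < p) f (twist p j *: toCn x) * Num.conj (g (twist p j *: toCn x))).

(* Functions on [hatS p] vanish off [hatS p], so the Z below is unique. *)
Definition is_zonal p m (eta : Cn) (Z : Cn -> C) : Prop :=
  Hhat p m Z /\ forall q, Hhat p m q -> q eta = inner p q Z.

Definition zonal p m (zeta eta : Cn) : C := xget (fun=> 0) (is_zonal p m eta) zeta.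

(* Z_l(e^(phi i) x, e^(psi i) y) := e^(l (phi - psi) i) Z_l(x, y) for x, y in S;
   the value does not depend on the chosen representations of zeta and eta. *)
Definition zonal_harmonic (l : nat) (zeta eta : Cn) : C :=
  xget 0 [set w | exists phi psi x y,
    [/\ sphere x, sphere y, zeta = expi phi *: toCn x, eta = expi psi *: toCn y &
        w = expi (l%:R * (phi - psi)) * zonal 1 l (toCn x) (toCn y)]].

Definition zonal_harmonicz (l : int) (zeta eta : Cn) : C :=
  if l is Posz l' then zonal_harmonic l' zeta eta else 0.

End polyharmonics.

Arguments hatS {R n} p.

(* Main.v *)
Require Import Defs.
From HB Require Import structures.
From mathcomp Require Import all_boot all_order all_algebra.
From mathcomp Require Import complex ring zify.
From mathcomp Require Import -(notations) mpoly.
From mathcomp Require Import all_classical all_reals all_analysis.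
From mathcomp Require Import measurable_realfun.

(** The twisted spheres e^(j pi i/p) S enter only through phases: if f and g are
    homogeneous of the same degree m, the factor e^(j m pi i/p) of f cancels
    against the conjugate factor of g, so the inner product over them is the
    L^2 product over S ([inner_hat_restr]). Hence Z_m^p is the reproducing
    kernel, for the L^2 product over S, of the polyharmonic polynomials of
    degree m.

    By the Almansi decomposition ([almansi]) such a polynomial is a sum over
    k < p of |x|^(2k) h_k with h_k harmonic of degree m - 2k. On S the factor
    |x|^(2k) is 1, and harmonic polynomials of distinct degrees are orthogonal
    there ([harmonic_orthogonal]). The reproducing kernel of an orthogonal sum is
    the sum of the kernels of its terms, which is the claimed formula
    ([polyharmonic_kerP]). All kernels are polynomials defined on the whole of
    C^n, homogeneous in the first variable and conjugate homogeneous in the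
    second, which is the rule by which zonal harmonics are extended from S to the
    twisted spheres ([harmonic_kerZ], [zonal_harmonicE]).

    Two facts about S remain: orthogonality, and the definiteness of the L^2
    product on harmonic polynomials, which makes the kernels exist
    ([harmonic_kernel]). Both follow from one identity ([sphere_mean_grad]): if h
    is homogeneous of degree k and g harmonic of degree l, then
      mean (grad h . grad g) = l (k + l + n - 2) mean (h g).
    If h is harmonic too, exchanging h and g gives orthogonality for k <> l; and
    if h is the conjugate of g, induction on the degree gives definiteness. The
    identity is the mean of the sum over i, j of L_ij (h x_i d_j g), where
    L_ij = x_i d_j - x_j d_i, since the mean of every L_ij u vanishes
    ([sphere_mean_rotgen]).

    That last fact is the infinitesimal form of the invariance of the measure of
    S under rotations of coordinate planes. The measure being defined by Lebesgue
    measures of cones, it is enough that these rotations preserve Lebesgue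
    measure: each is a product of three shears ([rotation_shear]), and a shear
    preserves Lebesgue measure because translations of R do
    ([lebesgue_tuple_shear]). *)

Set Implicit Arguments.
Unset Strict Implicit.
Unset Printing Implicit Defensive.

Import Order.TTheory GRing.Theory Num.Theory.

Local Open Scope classical_set_scope.
Local Open Scope ring_scope.
Local Open Scope complex_scope.

(** * Shears and rotations preserve Lebesgue measure *)

Section shear.
Context (R : realType).

Lemma lebesgue_measure_translation (a : R) (A : set R) : measurable A ->
  lebesgue_measure ((fun x => x + a) @^-1` A) = lebesgue_measure A.
Proof.
have mf : measurable_fun [set: measurableTypeR R]
    ((fun x => x + a) : _ -> measurableTypeR R) by exact: measurable_funD.
rewrite -[LHS]/(pushforward lebesgue_measure
    ((fun x => x + a) : _ -> measurableTypeR R) A) => mA.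
apply/esym/lebesgue_measure_unique => //= _ [[u v]] _ <-.
rewrite /pushforward (_ : _ @^-1` _ = `]u - a, v - a]%classic); last first.
  by apply/seteqP; split=> x /=; rewrite !in_itv /= ltrBlDr lerBrDr.
rewrite !lebesgue_measure_itv /= !lte_fin ltrD2r.
by case: ifP => // _; rewrite -!EFinD; congr (_%:E); ring.
Qed.

Definition shear n (i : 'I_n) (g : n.-tuple R -> R) (x : n.-tuple R) :
  n.-tuple R := [tuple tnth x j + (if j == i then g x else 0) | j < n].

Lemma measurable_shear n (i : 'I_n) (g : n.-tuple R -> R) :
  measurable_fun setT g -> measurable_fun setT (shear i g).
Proof.
move=> mg; apply/measurable_fun_tnthP => j.
rewrite (_ : _ \o _ = fun x => tnth x j + (if j == i then g x else 0)); last first.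
  by apply/funext => x /=; rewrite tnth_mktuple.
apply: measurable_funD; first exact: measurable_tnth.
by case: (j == i) => //; exact: measurable_cst.
Qed.

(** Along the [i]-th coordinate a shear is a translation, by an amount that the
    other coordinates determine, so the claim is Fubini's theorem. The induction
    peels the first coordinate off: if it is the sheared one, integrate over it
    innermost; otherwise each of its sections is a shear in one dimension less.
    A general [g], rather than a linear one, is what makes the sections
    fall under the induction hypothesis. *)
Lemma lebesgue_tuple_shear n (i : 'I_n) (g : n.-tuple R -> R)
    (A : set (n.-tuple R)) :
  measurable_fun setT g ->
  (forall x y, (forall j, j != i -> tnth x j = tnth y j) -> g x = g y) ->
  measurable A -> lebesgue_tuple R n (shear i g @^-1` A) = lebesgue_tuple R n A.
Proof.
elim: n i g A => [[]//|n IHn] i g A mg gi mA.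
have mcons := @measurable_tuple_cons R n.
have mconsI B : measurable B -> measurable (@tuple_cons R n @^-1` B).
  by move=> mB; rewrite -[X in measurable X]setTI; apply: mcons.
have mS : measurable (shear i g @^-1` A).
  by rewrite -[X in measurable X]setTI; apply: measurable_shear.
rewrite /= /lebesgue_cons /pushforward.
case: (unliftP ord0 i) => [k ->|->] in g gi mg mS *.
- apply: eq_integral => a _ /=.
  pose h (y : n.-tuple R) := g (tuple_cons (a, y)).
  have mh : measurable_fun setT h.
    apply: (measurableT_comp mg); apply: (measurableT_comp mcons).
    exact: measurable_pair1.
  rewrite -(IHn k h (xsection (@tuple_cons R n @^-1` A) a)) //.
  + congr (lebesgue_tuple R n _); apply/seteqP.
    suff E y : shear (lift ord0 k) g (tuple_cons (a, y)) =
           tuple_cons (a, shear k h y).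
      by split=> y; rewrite /xsection /= !inE /= E.
    apply: eq_from_tnth => j; rewrite tnth_mktuple.
    case: (unliftP ord0 j) => [l ->|->].
      by rewrite !tnthS tnth_mktuple (inj_eq lift_inj).
    by rewrite !tnth0 /= addr0.
  + move=> x y xy; apply: gi => j; case: (unliftP ord0 j) => [l ->|->].
      by rewrite (inj_eq lift_inj) !tnthS => /xy.
    by rewrite !tnth0.
  + by apply: measurable_xsection; apply: mconsI.
- have PE B : measurable B ->
      ((@lebesgue_measure R \x lebesgue_tuple R n) B =
       (@lebesgue_measure R \x^ lebesgue_tuple R n) B)%E.
    move=> mB; apply: product_measure_unique => // X Y mX mY.
    exact: product_measure2E.
  rewrite !PE; [|exact: mconsI|exact: mconsI].
  apply: eq_integral => y _ /=.
  set b := g (tuple_cons (0, y)).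
  rewrite -(@lebesgue_measure_translation b
    (ysection (@tuple_cons R n @^-1` A) y)); last first.
    by apply: measurable_ysection; apply: mconsI.
  congr (lebesgue_measure _); apply/seteqP.
  suff E a : shear ord0 g (tuple_cons (a, y)) = tuple_cons (a + b, y).
    by split=> a; rewrite /ysection /= !inE /= E.
  apply: eq_from_tnth => j; rewrite tnth_mktuple.
  case: (unliftP ord0 j) => [l ->|->].
    by rewrite !tnthS /= addr0.
  rewrite !tnth0 /=; congr (_ + _); apply: gi => l.
  by case: (unliftP ord0 l) => [l' ->|->//]; rewrite !tnthS.
Qed.

End shear.

Section rotation.
Context (R : realType) (n : nat) (i j : 'I_n) (t : R).
Implicit Types (x : n.-tuple R) (E : set (n.-tuple R)).

(** The rotation of the plane of the coordinates [i] and [j] by the angle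
    2 arctan t. The rational parametrisation by [t] turns invariance under these
    rotations into a polynomial identity in [t]. *)
Definition rotation x : n.-tuple R :=
  [tuple if k == i then ((1 - t ^+ 2) * tnth x i - 2 * t * tnth x j) / (1 + t ^+ 2)
         else if k == j then (2 * t * tnth x i + (1 - t ^+ 2) * tnth x j) / (1 + t ^+ 2)
         else tnth x k | k < n].

Let shear_i := shear i (fun x => - t * tnth x j).
Let shear_j := shear j (fun x => 2 * t / (1 + t ^+ 2) * tnth x i).

Let t1_neq0 : 1 + t ^+ 2 != 0.
Proof. by rewrite gt_eqF// ltr_pwDl// sqr_ge0. Qed.

(** The factorisation of a rotation into three shears, with parameters
    - tan (a / 2), sin a and - tan (a / 2) for the angle a. *)
Lemma rotation_shear : i != j -> rotation = shear_i \o shear_j \o shear_i.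
Proof.
move=> ij; have ji : j != i by rewrite eq_sym.
apply/funext => x; apply: eq_from_tnth => k.
have [->|ki] := eqVneq k i.
  by rewrite /= !(tnth_mktuple, eqxx, negbTE ij, negbTE ji, addr0); field.
have [->|kj] := eqVneq k j.
  by rewrite /= !(tnth_mktuple, eqxx, negbTE ij, negbTE ji, addr0); field.
by rewrite /= !(tnth_mktuple, eqxx, negbTE ki, negbTE kj, addr0).
Qed.

Lemma measurable_rotation : i != j -> measurable_fun setT rotation.
Proof.
move=> ij; rewrite rotation_shear//.
have mtnth k (c : R) : measurable_fun setT (fun x : n.-tuple R => c * tnth x k).
  by apply: measurable_funM => //; exact: measurable_tnth.
by do ![apply: measurableT_comp; last exact: measurable_shear
       |exact: measurable_shear].
Qed.

Lemma lebesgue_tuple_rotation E : i != j -> measurable E ->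
  lebesgue_tuple R n (rotation @^-1` E) = lebesgue_tuple R n E.
Proof.
move=> ij mE; have ji : j != i by rewrite eq_sym.
have mtnth k (c : R) : measurable_fun setT (fun x : n.-tuple R => c * tnth x k).
  by apply: measurable_funM => //; exact: measurable_tnth.
have mshear k l (c : R) F : measurable F ->
    measurable (shear k (fun x => c * tnth x l) @^-1` F).
  by move=> mF; rewrite -[X in measurable X]setTI; apply: measurable_shear.
rewrite rotation_shear// -[X in lebesgue_tuple R n X]/(shear_i @^-1`
  (shear_j @^-1` (shear_i @^-1` E))).
have mE1 : measurable (shear_i @^-1` E) by exact: mshear.
have mE2 : measurable (shear_j @^-1` (shear_i @^-1` E)) by exact: mshear.
by do 3 (rewrite lebesgue_tuple_shear//; last by move=> x y xy /=; rewrite xy).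
Qed.

Lemma sum_sqr_rotation x : i != j ->
  \sum_(k < n) tnth (rotation x) k ^+ 2 = \sum_(k < n) tnth x k ^+ 2.
Proof.
move=> ij; have ji : j != i by rewrite eq_sym.
rewrite (bigD1 i)// (bigD1 j)//= [RHS](bigD1 i)// [X in _ = _ + X](bigD1 j)//=.
rewrite !addrA; congr (_ + _); last first.
  by apply: eq_bigr => k /andP[/negbTE ki /negbTE kj]; rewrite tnth_mktuple ki kj.
by rewrite !tnth_mktuple eqxx (negbTE ji) eqxx; field.
Qed.

Lemma sphere_rotation : i != j -> rotation @^-1` @sphere R n = @sphere R n.
Proof.
by move=> ij; apply/seteqP; split=> x; rewrite /sphere /= sum_sqr_rotation.
Qed.

(** A rotation preserves norms and commutes with scalings. *)
Lemma cone_rotation E : i != j -> cone (rotation @^-1` E) = rotation @^-1` cone E.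
Proof.
move=> ij; have eR x : enorm (rotation x) = enorm x.
  by rewrite /enorm sum_sqr_rotation.
have rR x : radial (rotation x) = rotation (radial x).
  apply: eq_from_tnth => k; rewrite !tnth_mktuple eR.
  case: ifP => _; first by rewrite mulrA; congr (_ / _); ring.
  by case: ifP => _ //; rewrite mulrA; congr (_ / _); ring.
by rewrite !coneE; apply/seteqP; split=> x /=; rewrite eR rR.
Qed.

End rotation.

(** * Integration over the sphere *)

Section sphere_measure_invariance.
Context (R : realType).

Lemma sphere_measure_rotation n (i j : 'I_n) (t : R) (E : set (n.-tuple R)) :
  i != j -> measurable E ->
  @sphere_measure R n (rotation i j t @^-1` E) = @sphere_measure R n E.
Proof.
case: n => [|n] in i j E *; first by case: i.
move=> ij mE; rewrite !sphere_measureE; congr (_ * _)%E.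
rewrite /cone_measure; rewrite cone_rotation// lebesgue_tuple_rotation//.
exact: measurable_cone.
Qed.

Lemma measurable_sphere n : measurable (@sphere R n).
Proof.
rewrite (_ : @sphere R n = @enorm R n @^-1` [set 1]).
  by rewrite -[X in measurable X]setTI; exact: measurable_enorm.
by apply/seteqP; split=> x; rewrite /= => /sphere_enormP.
Qed.

Lemma sphere_measure_sphere n : @sphere_measure R n.+1 (@sphere R n.+1) = 1%E.
Proof.
rewrite sphere_measureE (_ : cone_measure _ = @cone_measure R n.+1 setT).
  rewrite -[X in (X * _)%E]fineK ?ge0_fin_numE ?cone_measureT_fin//.
  rewrite -EFinM divff// gt_eqF// fine_gt0//.
  by rewrite cone_measureT_gt0 cone_measureT_fin.
by rewrite /cone_measure /cone setIid setTI.
Qed.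

(** A class of functions, closed under sums and products, that contains the
    coordinates and consists of functions integrable over the sphere. *)
Definition sphere_bounded n (f : n.-tuple R -> R) :=
  measurable_fun setT f /\ exists B, forall x, sphere x -> `|f x| <= B.

Lemma sphere_bounded_integrable n (f : n.-tuple R -> R) : sphere_bounded f ->
  (@sphere_measure R n).-integrable (@sphere R n) (EFin \o f).
Proof.
move=> [mf [B fB]]; apply: measurable_bounded_integrable.
- exact: measurable_sphere.
- apply: (@le_lt_trans _ _ 1%E); last by rewrite ltry.
  by rewrite probability_le1//; exact: measurable_sphere.
- exact: measurable_funTS.
- exists B; split; first exact: num_real.
  by move=> M BM x Sx; exact: (le_trans (fB x Sx) (ltW BM)).
Qed.

Lemma integral_sphere_rotation n (i j : 'I_n) (t : R) (f : n.-tuple R -> R) :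
  i != j -> sphere_bounded f ->
  \int[@sphere_measure R n]_(x in @sphere R n) f (rotation i j t x) =
  \int[@sphere_measure R n]_(x in @sphere R n) f x.
Proof.
move=> ij [mf [B fB]]; have mrot := measurable_rotation t ij.
pose mu : {measure set (n.-tuple R) -> \bar R} := @sphere_measure R n.
pose nu : {measure set (n.-tuple R) -> \bar R} :=
  measure_function_pushforward__canonical__measure_function_Measure mu mrot.
have muE : forall A, measurable A -> A `<=` @sphere R n -> nu A = mu A.
  by move=> A mA _; exact: sphere_measure_rotation.
have Srot := sphere_rotation t ij.
rewrite /Rintegral -[in RHS](eq_measure_integral mu muE).
rewrite [in RHS](integral_pushforward mrot)//.
- by rewrite Srot.
- exact/measurable_EFinP.
- rewrite Srot; apply: sphere_bounded_integrable; split.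
    exact: measurableT_comp.
  by exists B => x Sx; apply: fB; rewrite -Srot in Sx.
- exact: measurable_sphere.
Qed.

End sphere_measure_invariance.

Section complex_sphere_integral.
Context (R : realType) (n : nat).
Local Notation C := R[i].
Implicit Types (f g : n.-tuple R -> C) (x : n.-tuple R).

Lemma conjE (z : C) : Num.conj z = z^*.
Proof. by []. Qed.

Lemma ReD (z w : C) : complex.Re (z + w) = complex.Re z + complex.Re w.
Proof. by case: z w => [? ?] [? ?]. Qed.

Lemma ImD (z w : C) : complex.Im (z + w) = complex.Im z + complex.Im w.
Proof. by case: z w => [? ?] [? ?]. Qed.

Lemma ReM (z w : C) : complex.Re (z * w) =
  complex.Re z * complex.Re w + (- complex.Im z) * complex.Im w.
Proof. by case: z w => [? ?] [? ?] /=; rewrite mulNr. Qed.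

Lemma ImM (z w : C) : complex.Im (z * w) =
  complex.Re z * complex.Im w + complex.Im z * complex.Re w.
Proof. by case: z w => [? ?] [? ?]. Qed.

Lemma sphere_bounded_cst (r : R) : @sphere_bounded R n (fun=> r).
Proof. by split; [exact: measurable_cst|exists `|r|]. Qed.

Lemma sphere_boundedD (f g : n.-tuple R -> R) :
  sphere_bounded f -> sphere_bounded g -> sphere_bounded (fun x => f x + g x).
Proof.
move=> [mf [B fB]] [mg [D gD]]; split; first exact: measurable_funD.
by exists (B + D) => x Sx; rewrite (le_trans (ler_normD _ _))// lerD ?fB ?gD.
Qed.

Lemma sphere_boundedM (f g : n.-tuple R -> R) :
  sphere_bounded f -> sphere_bounded g -> sphere_bounded (fun x => f x * g x).
Proof.
move=> [mf [B fB]] [mg [D gD]]; split; first exact: measurable_funM.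
by exists (B * D) => x Sx; rewrite normrM ler_pM ?fB ?gD.
Qed.

Lemma sphere_bounded_tnth (i : 'I_n) : sphere_bounded (fun x : n.-tuple R => tnth x i).
Proof.
split; first exact: measurable_tnth.
exists 1 => x Sx; rewrite -(@ler_pXn2r _ 2)// ?nnegrE// expr1n real_normK ?num_real//.
by rewrite -Sx (bigD1 i)//= lerDl; apply: sumr_ge0 => j _; exact: sqr_ge0.
Qed.

Definition csphere_bounded f :=
  sphere_bounded (fun x => complex.Re (f x)) /\
  sphere_bounded (fun x => complex.Im (f x)).

Lemma csphere_bounded_cst (c : C) : csphere_bounded (fun=> c).
Proof. by split; exact: sphere_bounded_cst. Qed.

Lemma csphere_boundedD f g : csphere_bounded f -> csphere_bounded g ->
  csphere_bounded (fun x => f x + g x).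
Proof.
move=> [f1 f2] [g1 g2]; split.
  by under [X in sphere_bounded X]funext do rewrite ReD; exact: sphere_boundedD.
by under [X in sphere_bounded X]funext do rewrite ImD; exact: sphere_boundedD.
Qed.

Lemma csphere_boundedM f g : csphere_bounded f -> csphere_bounded g ->
  csphere_bounded (fun x => f x * g x).
Proof.
move=> [f1 f2] [g1 g2]; split.
  under [X in sphere_bounded X]funext do rewrite ReM mulNr -mulN1r.
  by do ![exact: sphere_boundedD|apply: sphere_boundedD|
    apply: sphere_boundedM|apply: sphere_bounded_cst].
under [X in sphere_bounded X]funext do rewrite ImM.
by apply: sphere_boundedD; exact: sphere_boundedM.
Qed.

Lemma ReJ (z : C) : complex.Re z^* = complex.Re z.
Proof. by case: z. Qed.

Lemma ImJ (z : C) : complex.Im z^* = - complex.Im z.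
Proof. by case: z. Qed.

Lemma eq_sphere_integral f g :
  (forall x, sphere x -> f x = g x) -> sphere_integral f = sphere_integral g.
Proof.
move=> fg; rewrite /sphere_integral.
by congr (_ +i* _); apply: eq_Rintegral => x /set_mem Sx; rewrite fg.
Qed.

Lemma sphere_integralD f g : csphere_bounded f -> csphere_bounded g ->
  sphere_integral (fun x => f x + g x) = sphere_integral f + sphere_integral g.
Proof.
move=> [f1 f2] [g1 g2]; rewrite /sphere_integral.
under eq_Rintegral do rewrite ReD; under [X in _ +i* X]eq_Rintegral do rewrite ImD.
by rewrite !RintegralD//;
  (exact: measurable_sphere || exact: sphere_bounded_integrable).
Qed.

Lemma sphere_integralZ (c : C) f : csphere_bounded f ->
  sphere_integral (fun x => c * f x) = c * sphere_integral f.
Proof.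
move=> [f1 f2]; rewrite /sphere_integral.
have bZ (r : R) (h : n.-tuple R -> R) : sphere_bounded h ->
    sphere_bounded (fun x => r * h x).
  by move=> hb; apply: sphere_boundedM => //; exact: sphere_bounded_cst.
under eq_Rintegral do rewrite ReM; under [X in _ +i* X]eq_Rintegral do rewrite ImM.
have mS := @measurable_sphere R n.
rewrite !RintegralD ?RintegralZl//; do ?[exact: sphere_bounded_integrable
  |by apply: sphere_bounded_integrable; exact: bZ].
by case: c => a b /=; rewrite mulNr.
Qed.

Lemma sphere_integralJ f : csphere_bounded f ->
  sphere_integral (fun x => (f x)^*) = (sphere_integral f)^*.
Proof.
move=> [f1 f2]; rewrite /sphere_integral.
under eq_Rintegral do rewrite ReJ.
under [X in _ +i* X]eq_Rintegral do rewrite ImJ -mulN1r.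
rewrite RintegralZl; [|exact: measurable_sphere|exact: sphere_bounded_integrable].
by rewrite mulN1r.
Qed.

Lemma sphere_integral_ge0 f : (forall x, 0 <= f x) -> 0 <= sphere_integral f.
Proof.
move=> f0; rewrite /sphere_integral lecE /=; apply/andP; split.
  under eq_Rintegral => x _.
    have /andP[/eqP -> _] : (complex.Im (f x) == 0) && (0 <= complex.Re (f x)).
      by have := f0 x; rewrite lecE.
  over.
  rewrite Rintegral_cst; last exact: measurable_sphere.
  by rewrite mul0r.
apply: Rintegral_ge0 => x _.
by have := f0 x; rewrite lecE => /andP[].
Qed.

Lemma sphere_integral_rotation (i j : 'I_n) (t : R) f :
  i != j -> csphere_bounded f ->
  sphere_integral (fun x => f (rotation i j t x)) = sphere_integral f.
Proof.
move=> ij [f1 f2]; rewrite /sphere_integral; congr (_ +i* _).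
  exact: (integral_sphere_rotation t ij f1).
exact: (integral_sphere_rotation t ij f2).
Qed.

End complex_sphere_integral.

(** * Homogeneous polynomials *)

Section mpoly_complements.
Context (n : nat) (A : comNzRingType).
Local Notation XX i := (mpolyX A (mnm1 i)).
Implicit Types (u v : mpoly n A).

(** Induction on the way in which a polynomial is built by ring operations; it
    reduces identities between ring morphisms, or between derivations, to the
    variables. *)
Lemma mpoly_ring_ind (P : mpoly n A -> Prop) :
  (forall c, P (mpolyC n c)) -> (forall i, P (XX i)) ->
  (forall u v, P u -> P v -> P (u + v)) ->
  (forall u v, P u -> P v -> P (u * v)) -> forall u, P u.
Proof.
move=> PC PX PD PM u; elim/mpolyind: u => [|c m p _ _ Pp]; first by rewrite -mpolyC0.
apply: PD => //; rewrite -mul_mpolyC; apply: (PM) => //.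
have P1 : P 1 by rewrite -mpolyC1.
rewrite mpolyXE_id; apply: (big_ind P) => // i _.
by elim: (m i) => [//|k IHk]; rewrite exprS; exact: PM.
Qed.

Lemma meval_homog d (a : A) (x : 'I_n -> A) u : u \is ishomog1 d mdeg ->
  meval (fun k => a * x k) u = a ^+ d * meval x u.
Proof.
move=> /dhomogP ud; rewrite !mevalE mulr_sumr !big_seq; apply: eq_bigr => m mu.
rewrite mulrCA; congr (_ * _).
under eq_bigr do rewrite exprMn.
by rewrite big_split /= prodrXr -mdegE (ud m mu).
Qed.

Lemma mderivXU (i j : 'I_n) :
  mderiv j (XX i) = (i == j)%:R.
Proof.
rewrite mderivX mnm1E; have [->|_] := eqVneq i j; last by rewrite scale0r.
rewrite scale1r -(_ : mnm0 = mnm_sub (mnm1 j) (mnm1 j)) ?mpolyX0//.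
by apply/mnmP => k; rewrite mnm0E mnmBE subnn.
Qed.

Lemma mderiv_homog d (i : 'I_n) u :
  u \is ishomog1 d mdeg -> mderiv i u \is ishomog1 d.-1 mdeg.
Proof.
move=> /dhomogP ud; apply/dhomogP => m; rewrite mcoeff_msupp mcoeff_deriv => mu.
have : mdeg (mnm_add m (mnm1 i)) = d.
  apply: ud; rewrite mcoeff_msupp.
  by apply: contraNneq mu => ->; rewrite mul0rn.
by rewrite mdegD mdeg1 addn1 => <-.
Qed.

(** Euler's identity for homogeneous polynomials. *)
Lemma euler_homog d u : u \is ishomog1 d mdeg ->
  \sum_i XX i * mderiv i u = d%:R *: u.
Proof.
move=> /dhomogP ud; rewrite {1 2}(mpolyE u) scaler_sumr.
under eq_bigr => i _ do rewrite raddf_sum mulr_sumr.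
rewrite exchange_big /= !big_seq; apply: eq_bigr => m mu.
under eq_bigr => i _.
  rewrite mderivZ mderivX.
  have -> : XX i * (mcoeff m u *: ((m i)%:R *: mpolyX A (mnm_sub m (mnm1 i)))) =
      (m i)%:R *: (mcoeff m u *: mpolyX A m).
    rewrite -!scalerAr -mpolyXD !scalerA mulrC.
    have [->|mi] := eqVneq (m i) 0%N; first by rewrite !mul0r !scale0r.
    congr (_ *: mpolyX _ _); rewrite addmC submK//.
    by rewrite lep1mP.
  over.
by rewrite -scaler_suml -natr_sum -mdegE (ud m mu).
Qed.

Lemma homog0C u : u \is ishomog1 0 mdeg -> u = mpolyC n (mcoeff mnm0 u).
Proof.
move=> ud; apply/mpolyP => m; rewrite mcoeffC; have [->|m0] := eqVneq m mnm0.
  by rewrite mulr1.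
by rewrite mulr0; apply: (dhomog_nemf_coeff ud); rewrite mdeg_eq0.
Qed.

End mpoly_complements.

(** * Means of polynomials over the sphere *)

Section polynomial_integral.
Context (R : realType) (n : nat).
Local Notation C := R[i].
Implicit Types (u v : mpoly n C).

Definition sphere_eval u (x : n.-tuple R) : C := meval (toCn x 0) u.

Definition sphere_mean u : C := sphere_integral (sphere_eval u).

Lemma sphere_eval_bounded u : csphere_bounded (sphere_eval u).
Proof.
elim/mpoly_ring_ind: u => [c|i|u v bu bv|u v bu bv]; rewrite /sphere_eval.
- under [X in csphere_bounded X]funext do rewrite mevalC.
  exact: csphere_bounded_cst.
- under [X in csphere_bounded X]funext do rewrite mevalXU mxE.
  by split; [exact: sphere_bounded_tnth|exact: sphere_bounded_cst].
- under [X in csphere_bounded X]funext do rewrite mevalD.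
  exact: csphere_boundedD.
- under [X in csphere_bounded X]funext do rewrite mevalM.
  exact: csphere_boundedM.
Qed.

Lemma sphere_mean_is_linear : linear_for *%R sphere_mean.
Proof.
move=> c u v; rewrite /sphere_mean -sphere_integralZ; last exact: sphere_eval_bounded.
rewrite -sphere_integralD; first last.
- exact: sphere_eval_bounded.
- apply: csphere_boundedM; last exact: sphere_eval_bounded.
  exact: csphere_bounded_cst.
by apply: eq_sphere_integral => x _; rewrite /sphere_eval mevalD mevalZ.
Qed.

HB.instance Definition _ := GRing.isLinear.Build C (mpoly n C) C *%R sphere_mean
  sphere_mean_is_linear.

Lemma eq_sphere_mean u v : (forall x, sphere x -> sphere_eval u x = sphere_eval v x) ->
  sphere_mean u = sphere_mean v.
Proof. exact: eq_sphere_integral. Qed.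

(** On real points this is the complex conjugate, so that it lets the Hermitian
    product over the sphere be written as the mean of a polynomial. *)
Definition mconj : mpoly n C -> mpoly n C := map_mpoly Num.conj.

HB.instance Definition _ := GRing.RMorphism.copy mconj (map_mpoly Num.conj).

Lemma sphere_eval_mconj u x : sphere_eval (mconj u) x = Num.conj (sphere_eval u x).
Proof.
rewrite /sphere_eval; elim/mpolyind: u => [|c m p _ _ IHp].
  by rewrite /mconj !raddf0.
rewrite /mconj rmorphD /= map_mpolyZ map_mpolyX !mevalD !mevalZ !mevalX.
rewrite -/(mconj p) IHp rmorphD rmorphM rmorph_prod; congr (_ * _ + _).
apply: eq_bigr => i _; rewrite mxE rmorphXn /=; congr (_ ^+ _).
by rewrite conjE conjc_real.
Qed.

Lemma sphere_mean_mconj u : sphere_mean (mconj u) = Num.conj (sphere_mean u).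
Proof.
rewrite /sphere_mean conjE -sphere_integralJ; last exact: sphere_eval_bounded.
by apply: eq_sphere_integral => x _; rewrite sphere_eval_mconj.
Qed.

Lemma sphere_mean_ge0 u : 0 <= sphere_mean (u * mconj u).
Proof.
apply: sphere_integral_ge0 => x.
by rewrite /sphere_eval mevalM [X in _ * X]sphere_eval_mconj mul_conjC_ge0.
Qed.

(** The polynomial |x|^2, without conjugation. *)
Definition normsq : mpoly n C := \sum_(i < n) mpolyX C (mnm1 i) ^+ 2.

Lemma sphere_mean_normsq u : sphere_mean (normsq * u) = sphere_mean u.
Proof.
apply: eq_sphere_mean => x Sx; rewrite /sphere_eval mevalM raddf_sum /=.
rewrite (_ : \sum_(i < n) _ = 1) ?mul1r//.
have /(congr1 (real_complex R)) := Sx.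
rewrite rmorph_sum rmorph1 => <-; apply: eq_bigr => i _.
by rewrite rmorphXn /= mevalXU mxE rmorphXn.
Qed.

End polynomial_integral.

Lemma sphere_mean1 (R : realType) n : (0 < n)%N -> sphere_mean (1 : mpoly n R[i]) = 1.
Proof.
case: n => // n _.
rewrite /sphere_mean (@eq_sphere_integral _ _ _ (fun=> 1)); last first.
  by move=> x _; exact: meval1.
rewrite /sphere_integral /= !Rintegral_cst; [|exact: measurable_sphere..].
by rewrite [X in fine X]sphere_measure_sphere mul0r mul1r.
Qed.

(** * Infinitesimal rotations *)

Section rotation_generator.
Context (R : realType) (n : nat).
Local Notation C := R[i].
Local Notation P := (mpoly n C).
Local Notation XX i := (mpolyX C (mnm1 i)).
Implicit Types (u v : P).

(** The infinitesimal rotation L_ij of the plane of two coordinates. *)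
Definition rotgen (i j : 'I_n) u : P := XX i * mderiv j u - XX j * mderiv i u.

Lemma rotgenP i j c u v : rotgen i j (c *: u + v) = c *: rotgen i j u + rotgen i j v.
Proof.
rewrite /rotgen !mderivD !mderivZ !mulrDr -!scalerAr scalerBr.
by rewrite opprD addrACA.
Qed.

Section family.
Variables i j : 'I_n.
Hypothesis ij : i != j.

(** The coordinates of (1 + t^2) * rotation i j t x, as polynomials in t whose
    coefficients are polynomials in x. *)
Definition rotation_coord (k : 'I_n) : {poly P} :=
  if k == i then Poly [:: XX i; - 2 * XX j; - XX i]
  else if k == j then Poly [:: XX j; 2 * XX i; - XX j]
  else Poly [:: XX k; 0; XX k].

Definition rotation_subst : P -> {poly P} :=
  mmap (polyC \o @mpolyC n C) rotation_coord.

Lemma rotation_substD u v :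
  rotation_subst (u + v) = rotation_subst u + rotation_subst v.
Proof. exact: mmapD. Qed.

Lemma rotation_substM u v :
  rotation_subst (u * v) = rotation_subst u * rotation_subst v.
Proof. exact: (rmorphM (mmap _ _)). Qed.

Lemma rotation_substC c : rotation_subst (mpolyC n c) = (mpolyC n c)%:P.
Proof. exact: mmapC. Qed.

Lemma rotation_substX k : rotation_subst (XX k) = rotation_coord k.
Proof. by rewrite /rotation_subst mmapX mmap1U. Qed.

(** First order expansion at t = 0. The factor 2 arises because [t] is the
    tangent of half the angle. The coefficient of t is a derivation, so it is
    determined by its values at the variables. *)
Lemma rotation_subst_coef01 u :
  (rotation_subst u)`_0 = u /\ (rotation_subst u)`_1 = 2 * rotgen i j u.
Proof.
elim/mpoly_ring_ind: u => [c|k|u v [u0 u1] [v0 v1]|u v [u0 u1] [v0 v1]].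
- by rewrite rotation_substC !coefC /rotgen !mderivC !mulr0 subrr mulr0.
- rewrite rotation_substX /rotgen !mderivXU /rotation_coord.
  have [->|ki] := eqVneq k i.
    by rewrite (negbTE ij) !coef_Poly /=; split; ring.
  have [->|kj] := eqVneq k j.
    by rewrite !coef_Poly /=; split; ring.
  by rewrite !coef_Poly /=; split; ring.
- rewrite rotation_substD; move: u0 u1 v0 v1.
  move: (rotation_subst u) (rotation_subst v) => p q p0 p1 q0 q1.
  rewrite !coefD p0 p1 q0 q1; split; first exact: erefl.
  by rewrite /rotgen !mderivD; ring.
- rewrite rotation_substM; move: u0 u1 v0 v1.
  move: (rotation_subst u) (rotation_subst v) => p q p0 p1 q0 q1.
  rewrite !coefM !big_ord_recl !big_ord0 /= /bump /= p0 q0 p1 q1.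
  split; first by rewrite addr0.
  by rewrite /rotgen !mderivM; ring.
Qed.

Lemma sphere_eval_rotation_subst d (t : R) u x : u \is ishomog1 d mdeg ->
  sphere_eval (rotation_subst u).[mpolyC n t%:C] x =
  (1 + t ^+ 2)%:C ^+ d * sphere_eval u (rotation i j t x).
Proof.
move=> ud; rewrite -(meval_homog _ _ ud).
set y := fun k => _.
suff E v : sphere_eval (rotation_subst v).[mpolyC n t%:C] x = meval y v by exact: E.
elim/mpoly_ring_ind: v => [c|k|v w v0 w0|v w v0 w0].
- by rewrite rotation_substC hornerC /sphere_eval !mevalC.
- rewrite rotation_substX mevalXU /y mxE tnth_mktuple.
  have t0 : 1 + t ^+ 2 != 0 by rewrite gt_eqF// ltr_pwDl// sqr_ge0.
  have evP (a b c : P) : sphere_eval (Poly [:: a; b; c]).[mpolyC n t%:C] x =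
      sphere_eval a x + t%:C * sphere_eval b x + t%:C ^+ 2 * sphere_eval c x.
    rewrite horner_Poly /= /sphere_eval !(mevalD, mevalM, mevalC, meval0); ring.
  have evX l : sphere_eval (XX l) x = (tnth x l)%:C.
    by rewrite /sphere_eval mevalXU mxE.
  have evN w : sphere_eval (- w) x = - sphere_eval w x by exact: mevalN.
  have ev2 w : sphere_eval (2 * w) x = 2 * sphere_eval w x.
    by rewrite /sphere_eval mevalM -[2 in LHS]/(2%:R) raddfMn /= meval1.
  rewrite /rotation_coord -rmorphM /=.
  have [_|_] := eqVneq k i.
    by rewrite [in RHS]mulrC divfK// evP mulNr !(evN, ev2, evX); ring.
  have [_|_] := eqVneq k j.
    by rewrite [in RHS]mulrC divfK// evP !(evN, ev2, evX); ring.
  by rewrite evP -mpolyC0 !evX /sphere_eval mevalC; ring.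
- rewrite rotation_substD hornerD /sphere_eval [LHS]mevalD [RHS]mevalD.
  by congr (_ + _); [exact: v0|exact: w0].
- rewrite rotation_substM hornerM /sphere_eval [LHS]mevalM [RHS]mevalM.
  by congr (_ * _); [exact: v0|exact: w0].
Qed.

Lemma sphere_mean_horner (q : {poly P}) (c : C) :
  sphere_mean q.[mpolyC n c] = (\poly_(k < size q) sphere_mean q`_k).[c].
Proof.
rewrite horner_poly horner_coef raddf_sum; apply: eq_bigr => k _ /=.
by rewrite -rmorphXn mulrC mul_mpolyC linearZ mulrC.
Qed.

(** The mean of u ((1 + t^2) * rotation i j t x) is a polynomial in t; by
    homogeneity and rotation invariance it equals (1 + t^2)^d times the mean of
    u. The latter has no term of degree 1, while the coefficient of t of the
    former is twice the mean of L_ij u. *)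
Lemma sphere_mean_rotgen_homog d u :
  u \is ishomog1 d mdeg -> sphere_mean (rotgen i j u) = 0.
Proof.
move=> ud; set q := rotation_subst u.
pose r : {poly C} :=
  \poly_(k < size q) sphere_mean q`_k - (1 + 'X^2) ^+ d * (sphere_mean u)%:P.
have root_r (t : R) : r.[t%:C] = 0.
  rewrite /r hornerD hornerN hornerM horner_exp !hornerE -sphere_mean_horner.
  apply/eqP; rewrite subr_eq0; apply/eqP.
  have <- : (1 + t ^+ 2)%:C = 1 + t%:C ^+ 2 :> C by rewrite rmorphD rmorph1 rmorphXn.
  set c := (1 + t ^+ 2)%:C ^+ d.
  have -> : c * sphere_mean u = sphere_mean (c *: u) by rewrite linearZ.
  rewrite /sphere_mean -(sphere_integral_rotation t ij (sphere_eval_bounded (c *: u))).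
  apply: eq_sphere_integral => x _.
  by rewrite (sphere_eval_rotation_subst _ _ ud) /sphere_eval mevalZ.
(* [r] vanishes at all natural numbers, hence at too many points. *)
have r0 : r = 0.
  apply: (@roots_geq_poly_eq0 _ _ [seq k%:R | k <- iota 0 (size r)]).
  - apply/allP => _ /mapP[k _ ->]; apply/rootP.
    by rewrite -(root_r k%:R) rmorph_nat.
  - by rewrite map_inj_uniq ?iota_uniq//; exact: mulrIn (oner_neq0 _).
  - by rewrite size_map size_iota.
have := congr1 (fun s : {poly C} => s`_1) r0.
have e0 : ((1 + 'X^2 : {poly C}) ^+ d)`_1 = 0.
  elim: d {ud r root_r r0} => [|d IHd]; first by rewrite expr0 coef1.
  rewrite exprS coefM !big_ord_recl big_ord0 /= /bump /= IHd.
  by rewrite !coefD !coef1 !coefXn /=; ring.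
rewrite /r coefB coefMC e0 mul0r subr0 coef0 coef_poly.
have -> : (if (1 < size q)%N then sphere_mean q`_1 else 0) =
    2 * sphere_mean (rotgen i j u).
  have <- : sphere_mean q`_1 = 2 * sphere_mean (rotgen i j u).
    have [_ ->] := rotation_subst_coef01 u.
    by rewrite mulr_natl raddfMn mulr_natl.
  by case: ltnP => // q1; rewrite (nth_default _ q1) raddf0.
by move/eqP; rewrite mulf_eq0 pnatr_eq0 /= => /eqP.
Qed.

Lemma sphere_mean_rotgen u : sphere_mean (rotgen i j u) = 0.
Proof.
elim/mpolyind: u => [|c m p _ _ IHp].
  by rewrite /rotgen !mderiv0 !mulr0 subr0 raddf0.
rewrite rotgenP sphere_mean_is_linear IHp addr0.
by rewrite (@sphere_mean_rotgen_homog (mdeg m)) ?mulr0// dhomogX.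
Qed.

End family.
End rotation_generator.

(** * Orthogonality and definiteness for spherical harmonics *)

Section green.
Context (R : realType) (n : nat).
Local Notation C := R[i].
Local Notation P := (mpoly n C).
Local Notation XX i := (mpolyX C (mnm1 i)).
Implicit Types (u v g h : P).

(** By the Leibniz rule and Euler's identity. As n > 0, the natural number
    l (k + n.-1 + l.-1) is l (k + l + n - 2), also for l = 0. *)
Lemma sum_rotgen k l h g : h \is ishomog1 k mdeg -> g \is ishomog1 l mdeg ->
  laplacian g = 0 -> (0 < n)%N ->
  \sum_i \sum_j rotgen i j (h * (XX i * mderiv j g)) =
  normsq R n * (\sum_j mderiv j h * mderiv j g) - (l * (k + n.-1 + l.-1))%:R *: (h * g).
Proof.
move=> hk gl g0 n0.
have E i j : rotgen i j (h * (XX i * mderiv j g)) =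
  XX i ^+ 2 * (mderiv j h * mderiv j g) + h * (XX i * ((i == j)%:R * mderiv j g))
  + h * (XX i ^+ 2 * mderiv j (mderiv j g)) - (XX i * mderiv i h) * (XX j * mderiv j g)
  - h * (XX j * mderiv j g) - h * (XX i * (XX j * mderiv j (mderiv i g))).
  rewrite /rotgen !mderivM !mderivXU (mderiv_comm j i) eqxx mulr1n.
  move: (XX i) (XX j) (mderiv j (mderiv i g)) (mderiv j (mderiv j g)) => a b c d.
  move: (mderiv i h) (mderiv j h) (mderiv j g) ((i == j)%:R : P) => e f o p.
  by ring.
under eq_bigr => i _ do under eq_bigr => j _ do rewrite E.
under eq_bigr => i _ do rewrite !(sumrB, big_split) /=.
rewrite !(sumrB, big_split) /=.
have T1 : \sum_i \sum_j XX i ^+ 2 * (mderiv j h * mderiv j g) =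
    normsq R n * (\sum_j mderiv j h * mderiv j g).
  by rewrite /normsq mulr_suml; apply: eq_bigr => i _; rewrite mulr_sumr.
have T2 : \sum_i \sum_j h * (XX i * ((i == j)%:R * mderiv j g)) = l%:R *: (h * g).
  rewrite scalerAr -(euler_homog gl) mulr_sumr; apply: eq_bigr => i _.
  rewrite (bigD1 i)//= eqxx mul1r big1 ?addr0// => j; rewrite eq_sym => /negbTE ->.
  by rewrite mul0r !mulr0.
have T3 : \sum_i \sum_j h * (XX i ^+ 2 * mderiv j (mderiv j g)) = 0.
  apply: big1 => i _; rewrite -!mulr_sumr -[X in _ * (_ * X)]/(laplacian g) g0.
  by rewrite !mulr0.
have T4 : \sum_i \sum_j (XX i * mderiv i h) * (XX j * mderiv j g) =
    (k * l)%:R *: (h * g).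
  under eq_bigr => i _ do rewrite -mulr_sumr (euler_homog gl).
  rewrite -mulr_suml (euler_homog hk) -scalerAl -scalerAr scalerA.
  by rewrite natrM.
have T5 : \sum_(i < n) \sum_j h * (XX j * mderiv j g) = (n * l)%:R *: (h * g).
  under eq_bigr => i _ do rewrite -mulr_sumr (euler_homog gl).
  by rewrite sumr_const card_ord -scalerAr -scaler_nat scalerA natrM.
have T6 : \sum_i \sum_j h * (XX i * (XX j * mderiv j (mderiv i g))) =
    (l * l.-1)%:R *: (h * g).
  under eq_bigr => i _.
    rewrite -!mulr_sumr (euler_homog (mderiv_homog i gl)) -!scalerAr.
  over.
  by rewrite -scaler_sumr -mulr_sumr (euler_homog gl) -scalerAr scalerA mulrC natrM.
transitivity (normsq R n * (\sum_j mderiv j h * mderiv j g) + l%:R *: (h * g) + 0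
    - (k * l)%:R *: (h * g) - (n * l)%:R *: (h * g) - (l * l.-1)%:R *: (h * g)).
  congr (_ + _ + _ - _ - _ - _);
    [exact: T1|exact: T2|exact: T3|exact: T4|exact: T5|exact: T6].
have -> : (l * (k + n.-1 + l.-1))%:R =
    (k * l)%:R + (n * l)%:R + (l * l.-1)%:R - l%:R :> C.
  apply/eqP; rewrite eq_sym subr_eq -!natrD; apply/eqP; congr _%:R.
  by case: (n) n0 => // n' _ /=; ring.
move: (normsq R n * _) (h * g) => a b.
by rewrite addr0 !scalerBl !scalerDl !opprB !opprD !addrA addrAC; congr (_ + _).
Qed.

(** Green's identity on the sphere: the left-hand side of [sum_rotgen] has mean
    0, and |x|^2 = 1 on the sphere. *)
Lemma sphere_mean_grad k l h g : (0 < n)%N ->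
  h \is ishomog1 k mdeg -> g \is ishomog1 l mdeg -> laplacian g = 0 ->
  \sum_j sphere_mean (mderiv j h * mderiv j g) =
  (l * (k + n.-1 + l.-1))%:R * sphere_mean (h * g).
Proof.
move=> n0 hk gl g0; apply/eqP; rewrite -subr_eq0; apply/eqP.
have := congr1 (@sphere_mean R n) (sum_rotgen hk gl g0 n0).
rewrite linearB linearZ /= sphere_mean_normsq !raddf_sum /= => <-.
apply: big1 => i _; rewrite raddf_sum; apply: big1 => j _.
have [<-|ij] := eqVneq i j; last exact: sphere_mean_rotgen.
have rot0 w : rotgen i i w = 0 by exact: subrr.
by rewrite rot0 raddf0.
Qed.

(** The left-hand side of [sphere_mean_grad] is symmetric in [h] and [g], so
    l (k + l + n - 2) and k (k + l + n - 2) give the same multiple of the mean of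
    h g. In dimension at least 2 they differ, unless k = l. *)
Lemma harmonic_orthogonal k l h g : (1 < n)%N -> Hpoly 1 k h -> Hpoly 1 l g ->
  k != l -> sphere_mean (h * g) = 0.
Proof.
move=> n1 [hk h0] [gl g0] kl; have n0 : (0 < n)%N by exact: ltnW.
have e1 := sphere_mean_grad n0 hk gl g0; have e2 := sphere_mean_grad n0 gl hk h0.
have e3 : \sum_j sphere_mean (mderiv j h * mderiv j g) =
    \sum_j sphere_mean (mderiv j g * mderiv j h).
  by apply: eq_bigr => j _; rewrite mulrC.
rewrite (mulrC g h) in e2.
have := etrans (esym e1) (etrans e3 e2).
move: (sphere_mean (h * g)) => I; move/eqP.
rewrite -subr_eq0 -mulrBl mulf_eq0 subr_eq0 eqr_nat.
case/orP => [/eqP|/eqP//] E.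
case/eqP: kl; have E' a b : (a * (b + n.-1 + a.-1) = a * (a + b + n.-2))%N.
  by case: (n) n1 => [//|[//|n']] _; case: a => [//|a] /=; congr (_ * _)%N; lia.
move/eqP: E; rewrite !E' (addnC k) eqn_mul2r => /orP[|/eqP//].
by rewrite !addn_eq0 => /andP[/andP[/eqP -> /eqP ->]].
Qed.

Lemma sphere_mean_herm u v :
  sphere_mean (v * mconj u) = Num.conj (sphere_mean (u * mconj v)).
Proof.
rewrite -sphere_mean_mconj; congr sphere_mean.
rewrite [RHS]rmorphM mulrC; congr (_ * _).
by apply/mpolyP => m; rewrite !mcoeff_map_mpoly /= conjCK.
Qed.

Lemma mderiv_mconj i u : mderiv i (mconj u) = mconj (mderiv i u).
Proof.
apply/mpolyP => m; rewrite mcoeff_deriv !mcoeff_map_mpoly mcoeff_deriv.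
exact: (esym (raddfMn _ _ _)).
Qed.

Lemma laplacian_mconj u : laplacian (mconj u) = mconj (laplacian u).
Proof.
by rewrite /laplacian raddf_sum; apply: eq_bigr => i _; rewrite !mderiv_mconj.
Qed.

Lemma mconj_homog d u : u \is ishomog1 d mdeg -> mconj u \is ishomog1 d mdeg.
Proof.
move=> /dhomogP ud; apply/dhomogP => m; rewrite mcoeff_msupp mcoeff_map_mpoly.
rewrite fmorph_eq0 -mcoeff_msupp; exact: ud.
Qed.

Lemma Hpoly_mconj d u : Hpoly 1 d u -> Hpoly 1 d (mconj u).
Proof.
move=> [ud u0]; split; first exact: mconj_homog.
by rewrite [LHS]laplacian_mconj [laplacian u]u0 raddf0.
Qed.

Lemma laplacian_is_linear : linear (@laplacian R n).
Proof.
move=> c u v; rewrite /laplacian scaler_sumr -big_split; apply: eq_bigr => i _.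
by rewrite !(mderivD, mderivZ).
Qed.

HB.instance Definition _ := GRing.isLinear.Build C P P _ (@laplacian R n)
  laplacian_is_linear.

Lemma mderiv_laplacian i u : mderiv i (laplacian u) = laplacian (mderiv i u).
Proof.
rewrite /laplacian raddf_sum; apply: eq_bigr => j _ /=.
by rewrite (mderiv_comm j i (mderiv j u)) (mderiv_comm j i u).
Qed.

Lemma mderiv_eq0_homog d u : u \is ishomog1 d.+1 mdeg ->
  (forall i, mderiv i u = 0) -> u = 0.
Proof.
move=> ud u0; have := euler_homog ud.
rewrite big1 => [/esym/eqP|i _]; last by rewrite u0 mulr0.
by rewrite mscalerI pnatr_eq0 => /eqP.
Qed.

(** If h has norm 0, the norms of its partial derivatives, which are harmonic of
    smaller degree, have sum 0 by [sphere_mean_grad]. So the derivatives of h are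
    0, and h is 0 by Euler's identity. The induction ends at constants, whose
    norm is their modulus because the measure of the sphere is a probability. *)
Lemma sphere_mean_definite d h : (0 < n)%N -> Hpoly 1 d h ->
  sphere_mean (h * mconj h) = 0 -> h = 0.
Proof.
move=> n0; elim: d h => [|d IHd] h [hd h0] hh.
  move: hh; rewrite (homog0C hd) /mconj map_mpolyC -mpolyCM.
  rewrite -[mpolyC _ _]mulr1 mul_mpolyC.
  rewrite linearZ /= sphere_mean1// mulr1 => /eqP.
  by rewrite mul_conjC_eq0 => /eqP ->; rewrite mpolyC0.
have [hd' h0'] := Hpoly_mconj (conj hd h0).
apply: (mderiv_eq0_homog hd) => i.
apply: IHd.
  split; first exact: (mderiv_homog i hd).
  by rewrite /= -mderiv_laplacian [laplacian h]h0 mderiv0.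
have E : \sum_j sphere_mean (mderiv j h * mconj (mderiv j h)) = 0.
  apply: etrans (etrans (sphere_mean_grad n0 hd hd' h0') _).
    by apply: eq_bigr => j _; rewrite mderiv_mconj.
  exact: etrans (congr1 _ hh) (mulr0 _).
have /allP/(_ i) :
    all (fun j => true ==> (sphere_mean (mderiv j h * mconj (mderiv j h)) == 0))
        (index_enum 'I_n).
  by rewrite -psumr_eq0 => [|j _]; [apply/eqP; exact: E|exact: sphere_mean_ge0].
by rewrite mem_index_enum => /(_ isT)/eqP.
Qed.

End green.

(** * Almansi decomposition *)

Section almansi.
Context (R : realType) (n : nat).
Local Notation C := R[i].
Local Notation P := (mpoly n C).
Local Notation XX i := (mpolyX C (mnm1 i)).
Local Notation r2 := (normsq R n).
Implicit Types (u v w : P).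

Lemma iter_laplacianP p c u v :
  iter p (@laplacian R n) (c *: u + v) =
  c *: iter p (@laplacian R n) u + iter p (@laplacian R n) v.
Proof. by elim: p => //= p ->; rewrite linearP. Qed.

Lemma iter_laplacianZ p c u :
  iter p (@laplacian R n) (c *: u) = c *: iter p (@laplacian R n) u.
Proof. by elim: p => //= p ->; rewrite linearZ. Qed.

Lemma Hpoly_linear p m c u v : Hpoly p m u -> Hpoly p m v ->
  Hpoly p m (c *: u + v).
Proof.
move=> [um u0] [vm v0]; split; first by rewrite rpredD// rpredZ.
by rewrite iter_laplacianP u0 v0 scaler0 addr0.
Qed.

Lemma Hpoly0 p m : Hpoly p m (0 : P).
Proof.
split; first exact: rpred0.
by elim: p => //= p ->; rewrite raddf0.
Qed.

Lemma laplacian_homog d u :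
  u \is ishomog1 d mdeg -> laplacian u \is ishomog1 (d - 2) mdeg.
Proof.
move=> ud; apply: rpred_sum => i _.
by rewrite subn2; exact: (mderiv_homog i (mderiv_homog i ud)).
Qed.

Lemma laplacian_lowdeg d u : (d < 2)%N -> u \is ishomog1 d mdeg -> laplacian u = 0.
Proof.
move=> d2 ud; apply: big1 => i _.
have := mderiv_homog i ud.
rewrite (_ : d.-1 = 0%N); last by case: d d2 {ud} => [|[|]].
by move=> /homog0C ->; rewrite mderivC.
Qed.

Lemma laplacianM u v : laplacian (u * v) =
  laplacian u * v + 2 * (\sum_i mderiv i u * mderiv i v) + u * laplacian v.
Proof.
rewrite /laplacian mulr_suml !mulr_sumr -!big_split; apply: eq_bigr => i _ /=.
rewrite !mderivM !mderivD !mderivM.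
move: (mderiv i (mderiv i u)) (mderiv i u) (mderiv i (mderiv i v)) (mderiv i v).
by move=> a b c d; ring.
Qed.

Lemma mderiv_normsq i : mderiv i r2 = 2 * XX i.
Proof.
rewrite /normsq raddf_sum (bigD1 i)//= big1 => [|j ji].
  by rewrite addr0 expr2 mderivM mderivXU eqxx mul1r mulr1 mulr_natl mulr2n.
by rewrite expr2 mderivM mderivXU (negbTE ji) mul0r mulr0 addr0.
Qed.

Lemma normsqX_homog k d u : u \is ishomog1 d mdeg ->
  r2 ^+ k * u \is ishomog1 (2 * k + d) mdeg.
Proof.
move=> ud; apply: dhomogM => //; apply: dhomogMn.
apply: rpred_sum => i _; rewrite -[2%N]/(1 * 2)%N; apply: dhomogMn.
by rewrite dhomogX; apply/eqP; exact: mdeg1.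
Qed.

Lemma laplacian_normsq d w : w \is ishomog1 d mdeg ->
  laplacian (r2 * w) = (2 * n + 4 * d)%:R *: w + r2 * laplacian w.
Proof.
move=> wd; rewrite laplacianM; congr (_ + _).
have -> : laplacian r2 = (2 * n)%:R.
  rewrite /laplacian; under eq_bigr => i _.
    rewrite mderiv_normsq mulr_natl mderivMn mderivXU eqxx.
  over.
  by rewrite sumr_const card_ord mulr1n natrM mulr_natr.
have -> : \sum_i mderiv i r2 * mderiv i w = 2 * (d%:R *: w).
  rewrite -(euler_homog wd) mulr_sumr; apply: eq_bigr => i _.
  by rewrite mderiv_normsq mulrA.
rewrite natrD scalerDl; congr (_ + _).
  by rewrite scaler_nat mulr_natl.
by rewrite !mulr_natl !scaler_nat -!mulrnA; congr (_ *+ _); lia.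
Qed.

(** The sum of the contributions 2 n + 4 (2 j + d), for j <= k, of
    [laplacian_normsq]. *)
Lemma laplacian_normsqX k d v : Hpoly 1 d v ->
  laplacian (r2 ^+ k.+1 * v) = (2 * k.+1 * (n + 2 * k + 2 * d))%:R *: (r2 ^+ k * v).
Proof.
move=> [vd v0]; elim: k => [|k IHk].
  rewrite expr1 (laplacian_normsq vd) [laplacian v]v0 mulr0 addr0 expr0 mul1r.
  by congr (_%:R *: _); lia.
rewrite exprS -mulrA (laplacian_normsq (normsqX_homog k.+1 vd)) IHk.
rewrite -scalerAr mulrA -exprS.
by rewrite -scalerDl -natrD; congr (_%:R *: _); lia.
Qed.

(** The constant is the product of those of [laplacian_normsqX], all positive. *)
Lemma iter_laplacian_normsqX k d v : (0 < n)%N -> Hpoly 1 d v ->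
  exists2 c : C, c != 0 & iter k (@laplacian R n) (r2 ^+ k * v) = c *: v.
Proof.
move=> n0 vd; elim: k => [|k [c c0 IHk]].
  by exists 1; rewrite ?oner_eq0// expr0 mul1r scale1r.
exists ((2 * k.+1 * (n + 2 * k + 2 * d))%:R * c).
  rewrite mulf_neq0// pnatr_eq0; lia.
by rewrite iterSr (laplacian_normsqX k vd) iter_laplacianZ IHk scalerA.
Qed.

Lemma Hpoly_normsqX p k m v : (0 < n)%N -> (k < p)%N -> (2 * k <= m)%N ->
  Hpoly 1 (m - 2 * k) v -> Hpoly p m (r2 ^+ k * v).
Proof.
move=> n0 kp km vd; split.
  by rewrite -(subnKC km); exact: normsqX_homog vd.1.
have [c _ E] := iter_laplacian_normsqX k n0 vd.
rewrite -(subnK kp) iterD iterS E.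
rewrite (_ : laplacian (c *: v) = 0); last first.
  by have v0 : laplacian v = 0 := vd.2; rewrite linearZ /= v0 scaler0.
exact: (Hpoly0 _ 0).2.
Qed.

Lemma iter_laplacian_homog p m u : u \is ishomog1 m mdeg ->
  iter p (@laplacian R n) u \is ishomog1 (m - 2 * p) mdeg.
Proof.
move=> um; elim: p => [|p IHp]; first by rewrite muln0 subn0.
by rewrite iterS mulnS addnC subnDA; exact: laplacian_homog.
Qed.

Lemma iter_laplacian_lowdeg p m u : u \is ishomog1 m mdeg -> (m < 2 * p)%N ->
  iter p (@laplacian R n) u = 0.
Proof.
move=> um; elim: p => [|p IHp]; first by rewrite muln0.
move=> mp; rewrite iterS.
have [mp'|mp'] := ltnP m (2 * p); first by rewrite IHp// raddf0.
apply: (laplacian_lowdeg _ (iter_laplacian_homog p um)); lia.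
Qed.

(** The harmonic polynomial w, the (p - 1)-st Laplacian of u, is up to a nonzero
    factor also the (p - 1)-st Laplacian of |x|^(2 (p - 1)) w. Subtracting a
    multiple of the latter from u lowers the order. The components of negative
    degree m - 2 k, which natural numbers cannot index, are set to 0. *)
Lemma almansi p m u : (0 < n)%N -> Hpoly p m u -> exists2 v : nat -> P,
  (forall k, if (2 * k <= m)%N then Hpoly 1 (m - 2 * k) (v k) else v k = 0) &
  u = \sum_(k < p) r2 ^+ k * v k.
Proof.
move=> n0; elim: p u => [|p IHp] u [um u0].
  exists (fun=> 0); last by rewrite big_ord0.
  by move=> k; case: ifP => // _; exact: Hpoly0.
set w := iter p (@laplacian R n) u.
have wH : Hpoly 1 (m - 2 * p) w by split=> //; exact: iter_laplacian_homog.
have [c c0 Ec] := iter_laplacian_normsqX p n0 wH.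
have [v vH Ev] : exists2 v : nat -> P,
  (forall k, if (2 * k <= m)%N then Hpoly 1 (m - 2 * k) (v k) else v k = 0) &
  - c^-1 *: (r2 ^+ p * w) + u = \sum_(k < p) r2 ^+ k * v k.
  apply: IHp; split.
    apply: rpredD => //; apply: rpredZ.
    have [pm|pm] := leqP (2 * p) m.
      by rewrite -(subnKC pm); exact: normsqX_homog wH.1.
    by rewrite /w (iter_laplacian_lowdeg um pm) mulr0 rpred0.
  by rewrite iter_laplacianP Ec scalerA mulNr mulVf// scaleN1r addNr.
exists (fun k => if k == p then c^-1 *: w else v k).
  move=> k; case: (eqVneq k p) => [->|_]; last exact: vH.
  case: leqP => [_|pm].
    by have := Hpoly_linear c^-1 wH (Hpoly0 1 _); rewrite addr0.
  by rewrite /w (iter_laplacian_lowdeg um pm) scaler0.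
rewrite big_ord_recr /= eqxx -scalerAr.
under eq_bigr => k _ do rewrite ltn_eqF//.
by rewrite -Ev scaleNr addrAC addNr add0r.
Qed.

End almansi.

(** * Reproducing kernels of spherical harmonics *)

(** Riesz representation in finite dimension, for a Hermitian form that is
    definite on the subspace [U]: the Gram matrix of a basis of [U] is
    invertible, and inverting it gives the coordinates of the representative. *)
Section riesz.
Context (C : numClosedFieldType) (V : vectType C) (U : {vspace V}).
Variables (B : V -> V -> C) (phi : V -> C).
Hypothesis BP : forall a u v w, B (a *: u + v) w = a * B u w + B v w.
Hypothesis Bconj : forall u v, B v u = Num.conj (B u v).
Hypothesis Bdef : forall u, u \in U -> B u u = 0 -> u = 0.
Hypothesis phiP : forall a u v, phi (a *: u + v) = a * phi u + phi v.

Lemma riesz : exists2 g, g \in U & forall q, q \in U -> phi q = B q g.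
Proof.
have sumP (f : V -> C) : (forall a u v, f (a *: u + v) = a * f u + f v) ->
    forall d (c : 'I_d -> C) (b : 'I_d -> V),
    f (\sum_i c i *: b i) = \sum_i c i * f (b i).
  move=> fP; have f0 : f 0 = 0.
    by have := fP (-1) 0 0; rewrite scaler0 addr0 mulN1r addNr.
  elim=> [|d IHd] c b; first by rewrite !big_ord0.
  by rewrite !big_ord_recl fP IHd.
pose d := \dim U; pose b (i : 'I_d) := (vbasis U)`_i.
have bU i : b i \in U by rewrite vbasis_mem// mem_nth// size_tuple.
pose G := \matrix_(i < d, j < d) B (b i) (b j).
have uG : G \in unitmx.
  rewrite -row_free_unit; apply: inj_row_free => c cG.
  pose q := \sum_i c 0 i *: b i.
  have qU : q \in U by apply: memv_suml => i _; rewrite memvZ.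
  have qb j : B q (b j) = 0.
    rewrite (sumP (B^~ (b j)))//.
    transitivity ((c *m G) 0 j); last by rewrite cG mxE.
    by rewrite mxE; apply: eq_bigr => i _; rewrite mxE.
  have q0 : q = 0.
    apply: Bdef => //; rewrite {1}/q (sumP (B^~ q))// big1// => i _.
    by rewrite Bconj qb conjC0 mulr0.
  apply/rowP => i; rewrite mxE.
  by have /freeP/(_ (fun i => c 0 i) q0) := basis_free (vbasisP U).
pose a := invmx G *m \col_i phi (b i).
exists (\sum_j Num.conj (a j 0) *: b j).
  by apply: memv_suml => i _; rewrite memvZ.
move=> q qU; rewrite (coord_vbasis qU) (sumP phi)// (sumP (B^~ _))//.
apply: eq_bigr => i _; congr (_ * _).
rewrite Bconj (sumP (B^~ (b i)))// rmorph_sum.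
transitivity ((G *m a) i 0).
  by rewrite /a mulmxA mulmxV// mul1mx mxE.
rewrite mxE; apply: eq_bigr => j _; rewrite rmorphM /= conjCK mulrC; congr (_ * _).
by rewrite mxE -Bconj.
Qed.

End riesz.

Section kernel.
Context (R : realType).
Local Notation C := R[i].

Section harmonic_space.
Context (n l : nat).
Local Notation V := (dhomog n.+1 C l).

Definition dhomog_laplacian (u : V) : dhomog n.+1 C (l - 2) :=
  DHomog (laplacian_homog (dhomog_is_dhomog u)).

Lemma dhomog_laplacian_is_linear : linear dhomog_laplacian.
Proof. by move=> c u v; apply: val_inj; exact: laplacian_is_linear. Qed.

HB.instance Definition _ := GRing.isLinear.Build C V (dhomog n.+1 C (l - 2)) _
  dhomog_laplacian dhomog_laplacian_is_linear.

Definition harmonic_space : {vspace V} := lker (linfun dhomog_laplacian).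

Lemma harmonic_spaceP (u : V) :
  reflect (laplacian (mpoly_of_dhomog u) = 0) (u \in harmonic_space).
Proof.
rewrite memv_ker lfunE /=; apply: (iffP eqP) => [/(congr1 val)|u0] //.
exact: val_inj.
Qed.

End harmonic_space.

Lemma harmonic_kernel n l (w : 'rV[C]_n) : (0 < n)%N ->
  exists2 K : mpoly n C, Hpoly 1 l K &
    forall q, Hpoly 1 l q -> meval (w 0) q = sphere_mean (q * mconj K).
Proof.
case: n w => // n w _.
pose B (u v : dhomog n.+1 C l) :=
  sphere_mean (mpoly_of_dhomog u * mconj (mpoly_of_dhomog v)).
have [g gU gP] : exists2 g, g \in harmonic_space n l &
    forall q, q \in harmonic_space n l -> meval (w 0) (mpoly_of_dhomog q) = B q g.
  apply: (@riesz _ _ _ B (fun q => meval (w 0) (mpoly_of_dhomog q))).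
  - move=> a u v u'; rewrite /B -sphere_mean_is_linear; congr sphere_mean.
    by rewrite scalerAl -mulrDl.
  - by move=> u v; exact: sphere_mean_herm.
  - move=> u /harmonic_spaceP u0 Buu; apply: val_inj.
    apply: (sphere_mean_definite (d := l)) => //.
    by split=> //; exact: dhomog_is_dhomog.
  - by move=> a u v; rewrite -mevalZ -mevalD.
exists (mpoly_of_dhomog g).
  by split; [exact: dhomog_is_dhomog|exact/harmonic_spaceP].
move=> q [ql q0]; have := gP (DHomog ql); rewrite /B /=; apply.
exact/harmonic_spaceP.
Qed.

End kernel.

(** * Reproducing kernels of polyharmonics *)

Section reproducing_kernel.
Context (R : realType) (n : nat).
Local Notation C := R[i].
Local Notation P := (mpoly n C).
Local Notation r2 := (normsq R n).
Hypothesis n1 : (1 < n)%N.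
Implicit Types (u v q : P) (z w : 'rV[C]_n).

Let n0 : (0 < n)%N. Proof. exact: ltnW. Qed.

(** The point [w] is arbitrary in C^n: evaluation at w is a linear functional
    on polynomials, and defining kernels for all points yields their homogeneity
    in the pole. *)
Definition reproducing p m w (K : P) := Hpoly p m K /\
  forall q, Hpoly p m q -> meval (w 0) q = sphere_mean (q * mconj K).

(** Kernels are Hermitian: both sides are the product of L and K over the
    sphere. *)
Lemma reproducing_conj p m z w K L :
  reproducing p m z K -> reproducing p m w L ->
  meval (z 0) L = Num.conj (meval (w 0) K).
Proof.
move=> [Km KP] [Lm LP].
apply: etrans (KP _ Lm) (etrans (sphere_mean_herm _ _) _).
exact: esym (congr1 Num.conj (LP _ Km)).
Qed.

Definition harmonic_ker l w : P := xget 0 [set K | reproducing 1 l w K].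

Lemma harmonic_kerP l w : reproducing 1 l w (harmonic_ker l w).
Proof.
have [K KH KP] := @harmonic_kernel R n l w n0.
by apply: (@xgetPex _ 0 [set K | reproducing 1 l w K]); exists K.
Qed.

Lemma meval_homogZ d (a : C) z u : u \is ishomog1 d mdeg ->
  meval ((a *: z) 0) u = a ^+ d * meval (z 0) u.
Proof.
move=> ud; rewrite -(meval_homog _ _ ud); apply: meval_eq => i.
by rewrite mxE.
Qed.

(** Homogeneity in the point is that of a polynomial; homogeneity in the pole
    follows by Hermitian symmetry. *)
Lemma harmonic_kerZ l (a b : C) z w :
  meval ((a *: z) 0) (harmonic_ker l (b *: w)) =
  a ^+ l * Num.conj b ^+ l * meval (z 0) (harmonic_ker l w).
Proof.
have kH w' := (harmonic_kerP l w').1.1.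
rewrite (meval_homogZ _ _ (kH _)) -mulrA; congr (_ * _).
rewrite (reproducing_conj (harmonic_kerP l z) (harmonic_kerP l (b *: w))).
rewrite (meval_homogZ _ _ (kH _)) rmorphM rmorphXn; congr (_ * _).
exact: esym (reproducing_conj (harmonic_kerP l z) (harmonic_kerP l w)).
Qed.

Definition shifted_ker m w k : P :=
  if (2 * k <= m)%N then harmonic_ker (m - 2 * k) w else 0.

Definition polyharmonic_ker p m w : P :=
  \sum_(k < p) Num.conj (meval (w 0) r2) ^+ k *: (r2 ^+ k * shifted_ker m w k).

Lemma mconjZ (c : C) u : mconj (c *: u) = Num.conj c *: mconj u.
Proof. exact: map_mpolyZ. Qed.

Lemma mconj_normsq : mconj r2 = r2.
Proof.
rewrite /normsq raddf_sum; apply: eq_bigr => i _.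
by rewrite /= rmorphXn; congr (_ ^+ _); exact: map_mpolyX.
Qed.

Lemma sphere_mean_normsqX k u : sphere_mean (r2 ^+ k * u) = sphere_mean u.
Proof.
elim: k => [|k IHk]; first by rewrite expr0 mul1r.
by rewrite exprS -mulrA sphere_mean_normsq.
Qed.

Lemma mconj_polyharmonic_ker p m w : mconj (polyharmonic_ker p m w) =
  \sum_(k < p) meval (w 0) r2 ^+ k *: (r2 ^+ k * mconj (shifted_ker m w k)).
Proof.
rewrite /polyharmonic_ker (@raddf_sum _ _ (@mconj R n)); apply: eq_bigr => k _ /=.
rewrite mconjZ rmorphXn /= conjCK rmorphM; congr (_ *: (_ * _)).
by rewrite rmorphXn; congr (_ ^+ _); exact: mconj_normsq.
Qed.

(** In the Almansi decomposition of q, the product with the k-th term of the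
    kernel sees only the k-th component, by orthogonality; it reproduces the
    value of that component at [w], and the coefficient restores the factor
    |w|^(2k) lost on the sphere. *)
Lemma polyharmonic_kerP p m w : reproducing p m w (polyharmonic_ker p m w).
Proof.
split.
  rewrite /polyharmonic_ker; elim/big_ind: _ => [|u v uH vH|k _].
  - exact: Hpoly0.
  - by rewrite -[u]scale1r; exact: Hpoly_linear.
  - rewrite -[_ *: _]addr0; apply: Hpoly_linear; last exact: Hpoly0.
    rewrite /shifted_ker; case: ifP => km; last by rewrite mulr0; exact: Hpoly0.
    by apply: Hpoly_normsqX => //; exact: (harmonic_kerP _ _).1.
move=> q qH; have [v vH ->] := almansi n0 qH.
rewrite (@raddf_sum _ _ (meval (w 0))) mulr_suml (@raddf_sum _ _ (@sphere_mean R n)).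
apply: eq_bigr => j _; rewrite mconj_polyharmonic_ker mulr_sumr.
rewrite (@raddf_sum _ _ (@sphere_mean R n)) /= (bigD1 j)//=.
have E (k : nat) : sphere_mean (r2 ^+ j * v j *
      (meval (w 0) r2 ^+ k *: (r2 ^+ k * mconj (shifted_ker m w k)))) =
    meval (w 0) r2 ^+ k * sphere_mean (v j * mconj (shifted_ker m w k)).
  by rewrite -scalerAr linearZ /= -mulrA sphere_mean_normsqX mulrCA sphere_mean_normsqX.
rewrite big1 => [|k kj]; last first.
  apply: etrans (E k) _; move: (vH j); rewrite /shifted_ker.
  case: ifP => jm vj; last by rewrite vj mul0r raddf0 mulr0.
  case: ifP => km; last by rewrite raddf0 mulr0 raddf0 mulr0.
  have jk : (m - 2 * j != m - 2 * k)%N.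
    by apply: contra kj => /eqP jk; apply/eqP/val_inj => /=; lia.
  apply: etrans (congr1 _ (harmonic_orthogonal n1 vj _ jk)) (mulr0 _).
  exact: Hpoly_mconj (harmonic_kerP _ _).1.
rewrite addr0; apply: etrans (esym (E j)); rewrite [LHS]mevalM rmorphXn; congr (_ * _).
rewrite /shifted_ker; move: (vH j); case: ifP => jm vj.
  exact: (harmonic_kerP _ _).2.
by rewrite vj mul0r meval0 raddf0.
Qed.

End reproducing_kernel.

(** * Zonal functions *)

Section expi.
Context (R : realType).
Implicit Types (s t : R).

Lemma expi0 : expi 0 = 1 :> R[i].
Proof. by rewrite /expi cos0 sin0. Qed.

Lemma expiD s t : expi (s + t) = expi s * expi t.
Proof.
rewrite /expi cosD sinD; apply/eqP; rewrite eq_complex /= eqxx /=.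
by apply/eqP; ring.
Qed.

Lemma expiJ t : Num.conj (expi t) = expi (- t).
Proof. by rewrite /expi cosN sinN. Qed.

Lemma expiJK t : expi t * Num.conj (expi t) = 1.
Proof. by rewrite expiJ -expiD subrr expi0. Qed.

Lemma expiX k t : expi t ^+ k = expi (k%:R * t).
Proof.
elim: k => [|k IHk]; first by rewrite mul0r expr0 expi0.
by rewrite exprS IHk -expiD -natr1 mulrDl mul1r addrC.
Qed.

End expi.

Section zonal.
Context (R : realType) (n : nat).
Local Notation C := R[i].
Local Notation P := (mpoly n C).
Hypothesis n1 : (1 < n)%N.
Implicit Types (u v q : P) (z w : 'rV[C]_n).

Let n0 : (0 < n)%N. Proof. exact: ltnW. Qed.

(** The form in which [Hhat] represents the restriction of a polynomial. *)
Definition hat_restr p u : 'rV[C]_n -> C :=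
  patch (fun=> 0) (hatS p) (fun z => meval (z 0) u).

Lemma hat_restrE p u z : hatS p z -> hat_restr p u z = meval (z 0) u.
Proof. by move=> zp; rewrite /hat_restr /patch mem_set. Qed.

Lemma hatS_twist p j (x : n.-tuple R) : (j < p)%N -> sphere x ->
  hatS p (twist R p j *: toCn x).
Proof. by move=> jp Sx; exists j => //; exists x. Qed.

Lemma hatS1 (x : n.-tuple R) : sphere x -> hatS 1 (toCn x).
Proof.
move=> Sx; have := @hatS_twist 1 0 x isT Sx.
by rewrite /twist mul0r mul0r expi0 scale1r.
Qed.

(** The phases of the two factors are conjugate and cancel. *)
Lemma inner_hat_restr p m u v : (0 < p)%N ->
  u \is ishomog1 m mdeg -> v \is ishomog1 m mdeg ->
  inner p (hat_restr p u) (hat_restr p v) = sphere_mean (u * mconj v).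
Proof.
move=> p0 um vm; rewrite /inner.
rewrite (@eq_sphere_integral _ _ _ (fun x => p%:R * sphere_eval (u * mconj v) x)).
  rewrite sphere_integralZ; last exact: sphere_eval_bounded.
  by rewrite mulrA mulVf ?mul1r// pnatr_eq0 -lt0n.
move=> x Sx.
transitivity (\sum_(j < p) sphere_eval (u * mconj v) x); last first.
  by rewrite sumr_const card_ord mulr_natl.
apply: eq_bigr => j _.
rewrite !hat_restrE; [|exact: hatS_twist..].
rewrite (meval_homogZ _ _ um) (meval_homogZ _ _ vm) rmorphM rmorphXn.
rewrite mulrACA -exprMn expiJK expr1n mul1r.
rewrite -[X in _ * X]sphere_eval_mconj.
exact: (esym (mevalM _ _ _)).
Qed.

(** The polynomial kernel F has the property that defines the zonal function;
    it is the only one: if Z has it too, then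
    Z (z) = <Z, F_z> = conj <F_z, Z> = conj F_z (w) = F_w (z). *)
Lemma zonalE p m z w : (0 < p)%N -> hatS p z -> hatS p w ->
  zonal p m z w = meval (z 0) (polyharmonic_ker p m w).
Proof.
move=> p0 zp wp.
have kerP w' := polyharmonic_kerP n1 p m w'.
have [[u [um u0] uZ] ZP] : is_zonal p m w (xget (fun=> 0) (is_zonal p m w)).
  apply: xgetPex; exists (hat_restr p (polyharmonic_ker p m w)); split.
    by exists (polyharmonic_ker p m w) => //; exact: (kerP w).1.
  move=> _ [q qH <-].
  apply: etrans (hat_restrE q wp) _.
  apply: etrans ((kerP w).2 _ qH) _.
  exact: esym (inner_hat_restr p0 qH.1 (kerP w).1.1).
rewrite /zonal -uZ; apply: etrans (hat_restrE u zp) _.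
apply: etrans ((kerP z).2 _ (conj um u0)) _.
apply: etrans (sphere_mean_herm _ _) _.
apply: etrans (esym (reproducing_conj (kerP z) (kerP w))).
congr Num.conj.
have kH : Hhat p m (hat_restr p (polyharmonic_ker p m z)).
  by exists (polyharmonic_ker p m z) => //; exact: (kerP z).1.
have := ZP _ kH; rewrite -uZ => Z1.
apply: etrans (esym (inner_hat_restr p0 (kerP z).1.1 um)) _.
by apply: etrans (esym Z1) _; exact: hat_restrE.
Qed.

Lemma zonal1E l (x y : n.-tuple R) : sphere x -> sphere y ->
  zonal 1 l (toCn x) (toCn y) = meval (toCn x 0) (harmonic_ker l (toCn y)).
Proof.
move=> Sx Sy; rewrite zonalE//; [|exact: hatS1..].
rewrite /polyharmonic_ker big_ord1 !expr0 scale1r mul1r /shifted_ker.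
by rewrite muln0 leq0n subn0.
Qed.

(** Whichever representation of z and w by phases and real points is picked,
    homogeneity of the kernel restores its value at (z, w). *)
Lemma zonal_harmonicE p l z w : hatS p z -> hatS p w ->
  zonal_harmonic l z w = meval (z 0) (harmonic_ker l w).
Proof.
move=> [i _ [x Sx zE]] [j _ [y Sy wE]].
rewrite /zonal_harmonic.
set A := (X in xget 0 X).
have [phi [psi [x' [y' [Sx' Sy' -> -> ->]]]]] : A (xget 0 A).
  apply: xgetPex; eexists; exists (i%:R * pi / p%:R), (j%:R * pi / p%:R), x, y.
  by split; [exact: Sx|exact: Sy|exact: esym|exact: esym|reflexivity].
rewrite zonal1E// harmonic_kerZ// expiJ !expiX -expiD; congr (_ * _).
by congr expi; ring.
Qed.

End zonal.

(** * The expansion of zonal polyharmonics *)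

Theorem theorem2 (R : realType) (p n m : nat) (zeta eta : 'rV[R[i]]_n) :
  (1 <= p)%N -> (2 <= n)%N -> hatS p zeta -> hatS p eta ->
  zonal p m zeta eta =
  \sum_(k < p) cnorm zeta ^+ (2 * k) * cnorm (map_mx Num.conj eta) ^+ (2 * k) *
               zonal_harmonicz (m%:Z - (2 * k)%:Z) zeta eta.
Proof.
move=> p1 n2 zp wp; rewrite zonalE// /polyharmonic_ker (@raddf_sum _ _ (meval _)) /=.
apply: eq_bigr => k _; rewrite mevalZ mevalM rmorphXn.
have cn (z : 'rV[R[i]]_n) : cnorm z ^+ (2 * k) = meval (z 0) (normsq R n) ^+ k.
  rewrite exprM sqr_sqrtc; congr (_ ^+ _).
  rewrite /normsq raddf_sum; apply: eq_bigr => i _ /=.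
  by rewrite rmorphXn /= mevalXU.
rewrite !cn mulrCA mulrA; congr (_ * _ * _).
  congr (_ ^+ _).
  rewrite /normsq !(@raddf_sum _ _ (meval _)) /= rmorph_sum; apply: eq_bigr => i _ /=.
  by rewrite !rmorphXn /= !mevalXU mxE.
rewrite /shifted_ker; case: leqP => mk.
  rewrite subzn// /zonal_harmonicz.
  by rewrite (zonal_harmonicE _ _ zp wp).
rewrite meval0 (_ : m%:Z - (2 * k)%:Z = Negz (2 * k - m).-1)//.
by rewrite NegzE; lia.
Qed.
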